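(* Let $d\ge 1$ and $n\ge 2$ be integers, let $K$ be any field, and let $L_n=L_K(1,n)$ denote the Leavitt algebra of type $(1,n-1)$ with coefficients in $K$. Then $L_n\cong \mathrm{M}_d(L_n)$ as $K$-algebras if and only if $\gcd(d,n-1)=1$.
   Context: For a field $K$ and an integer $n\ge 2$, the Leavitt algebra $L_n=L_K(1,n)$ is the unital associative $K$-algebra generated by $x_1,\dots,x_n,y_1,\dots,y_n$ subject to the relations $x_iy_j=\delta_{ij}1$ for $1\le i,j\le n$ and $\sum_{j=1}^n y_jx_j=1$. $\mathrm{M}_d(R)$ denotes the ring of $d\times d$ matrices over $R$. *)

(* Defs.v *)
From HB Require Import structures.
From mathcomp Require Import all_boot all_order all_algebra.
From mathcomp Require Import boolp.
From mathcomp.multinomials Require Import monalg.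

Set Implicit Arguments.
Unset Strict Implicit.
Unset Printing Implicit Defensive.

Import GRing.Theory.
Import Quotient.

Local Open Scope ring_scope.
Local Open Scope quotient_scope.

(* The two-sided ideal of a (noncommutative) ring generated by a set [S].     *)
(* Closure under opposites follows from [span_mull] with [a := -1].           *)
Inductive ideal_span (R : nzRingType) (S : R -> Prop) : R -> Prop :=
| span_gen p of S p : ideal_span S p
| span0 : ideal_span S 0
| spanD p q of ideal_span S p & ideal_span S q : ideal_span S (p + q)
| span_mull a p of ideal_span S p : ideal_span S (a * p)
| span_mulr a p of ideal_span S p : ideal_span S (p * a).

Section Presentation.
Variables (K : fieldType) (n : nat).

(* Free associative algebra on x_1, ..., x_n, y_1, ..., y_n: the monoid       *)
(* algebra over [K] of the free monoid (words) on 'I_n + 'I_n, with [inl i]   *)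
(* for x_(i+1) and [inr j] for y_(j+1).                                       *)
Definition leavitt_free := {malg K[{fmonom ('I_n + 'I_n)%type}]}.

Definition free_x (i : 'I_n) : leavitt_free := << fmu (inl i) >>.
Definition free_y (j : 'I_n) : leavitt_free := << fmu (inr j) >>.

Inductive leavitt_rel : leavitt_free -> Prop :=
| leavitt_rel_xy i j : leavitt_rel (free_x i * free_y j - (i == j)%:R)
| leavitt_rel_yx : leavitt_rel (\sum_(j < n) free_y j * free_x j - 1).

Definition leavitt_ideal : {pred leavitt_free} :=
  fun p => `[< ideal_span leavitt_rel p >].

Lemma leavitt_idealP p :
  reflect (ideal_span leavitt_rel p) (p \in leavitt_ideal).
Proof. exact: asboolP. Qed.

Fact leavitt_ideal_zmod_closed : zmod_closed leavitt_ideal.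
Proof.
split=> [|p q /leavitt_idealP Ip /leavitt_idealP Iq]; apply/leavitt_idealP.
  exact: span0.
by rewrite -[- q]mulN1r; apply: spanD => //; apply: span_mull.
Qed.

HB.instance Definition _ :=
  GRing.isZmodClosed.Build leavitt_free leavitt_ideal leavitt_ideal_zmod_closed.

Lemma leavitt_ideal_mull a p : p \in leavitt_ideal -> a * p \in leavitt_ideal.
Proof. by move=> /leavitt_idealP Ip; apply/leavitt_idealP/span_mull. Qed.

Lemma leavitt_ideal_mulr a p : p \in leavitt_ideal -> p * a \in leavitt_ideal.
Proof. by move=> /leavitt_idealP Ip; apply/leavitt_idealP/span_mulr. Qed.

Lemma leavitt_ideal_scale (k : K) (p : leavitt_free) :
  p \in leavitt_ideal -> k *: p \in leavitt_ideal.
Proof. by rewrite -mul_malgC; apply: leavitt_ideal_mull. Qed.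

Lemma free_scalerAr (k : K) (p q : leavitt_free) : k *: (p * q) = p * (k *: q).
Proof.
have comm : p * k%:MP = k *: p.
  rewrite malgM_def fgmulgU [p in RHS]monalgE scaler_sumr.
  apply: eq_bigr => m _; rewrite mulm1; apply/malgP=> m'.
  by rewrite mcoeffZ !mcoeffU mulrC mulrnAr.
by rewrite -[k *: q]mul_malgC mulrA comm scalerAl.
Qed.

(* 1 is not in the ideal: for n > 0 the free algebra acts on functions        *)
(* v : nat -> K by (x_i v) m = v (n m + i) and (y_j v) m = v (m / n) if       *)
(* m = j mod n and 0 otherwise, and the relations act as zero.                *)

Let word_act (w : seq ('I_n + 'I_n)%type) (v : nat -> K) : nat -> K :=
  foldr (fun (g : 'I_n + 'I_n) u m => match g with
    | inl i => u (n * m + i)%N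
    | inr j => if (m %% n)%N == j :> nat then u (m %/ n)%N else 0
    end) v w.

Let free_act (p : leavitt_free) (v : nat -> K) m :=
  mmap idfun (fun w : {fmonom ('I_n + 'I_n)%type} => word_act w v m) p.

Let free_actU k w v m : free_act << k *g w >> v m = k * word_act w v m.
Proof. by rewrite /free_act mmapU. Qed.

Let free_act1 v m : free_act 1 v m = v m.
Proof. by rewrite free_actU fm1 mul1r. Qed.

Let free_actD p q v m : free_act (p + q) v m = free_act p v m + free_act q v m.
Proof. by rewrite /free_act raddfD. Qed.

Let free_act_sum (I : Type) (r : seq I) (F : I -> leavitt_free) v m :
  free_act (\sum_(i <- r) F i) v m = \sum_(i <- r) free_act (F i) v m.
Proof. by rewrite /free_act raddf_sum. Qed.

Let word_act_lin w (I : Type) (r : seq I) (c : I -> K) (u : I -> nat -> K) m :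
  word_act w (fun l => \sum_(i <- r) c i * u i l) m =
  \sum_(i <- r) c i * word_act w (u i) m.
Proof.
elim: w m => [|[i|j] w IH] m //=.
by case: ifP => _; rewrite ?IH // big1 // => i _; rewrite mulr0.
Qed.

Let free_actM p q v m : free_act (p * q) v m = free_act p (free_act q v) m.
Proof.
rewrite malgME free_act_sum [RHS]mmapE; apply: eq_bigr => w1 _.
rewrite free_act_sum.
under eq_bigr => w2 _ do rewrite free_actU fmM {1}/word_act foldr_cat -mulrA.
by rewrite -mulr_sumr; congr (_ * _); rewrite [RHS]word_act_lin.
Qed.

Hypothesis n_gt0 : (0 < n)%N.

Let act_rel p : leavitt_rel p -> forall v m, free_act p v m = 0.
Proof.
case=> [i j v m|v m].
  rewrite /free_act raddfB raddfMn /= -/(free_act _ v m) -/(free_act 1 v m).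
  rewrite free_actM free_act1 free_actU fmU /= mul1r free_actU fmU /= mul1r.
  rewrite mulnC modnMDl modn_small // divnMDl // divn_small // addn0.
  rewrite -val_eqE /=; case: eqP => _; first by rewrite subrr.
  by rewrite mulr0n subr0.
rewrite /free_act raddfB /= -/(free_act _ v m) -/(free_act 1 v m).
rewrite free_act_sum free_act1.
pose j0 := Ordinal (ltn_pmod m n_gt0).
rewrite (bigD1 j0) //= big1 ?addr0.
  rewrite free_actM free_actU fmU /= eqxx mul1r free_actU fmU /= mul1r.
  by rewrite mulnC -divn_eq subrr.
move=> j; rewrite -val_eqE /= => /negPf j_neq.
by rewrite free_actM free_actU fmU /= eq_sym j_neq mulr0.
Qed.

Lemma leavitt_ideal1 : 1 \notin leavitt_ideal.
Proof.
apply/leavitt_idealP => I1.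
suff act0 p : ideal_span leavitt_rel p -> forall v m, free_act p v m = 0.
  have := act0 _ I1 (fun=> 1) 0%N.
  by rewrite free_act1 => /eqP; rewrite oner_eq0.
elim=> {p} [p /act_rel //|v m|p q _ p0 _ q0 v m|a p _ p0 v m|a p _ p0 v m].
- by rewrite /free_act raddf0.
- by rewrite free_actD p0 q0 addr0.
- rewrite free_actM (_ : free_act p v = fun=> 0); last first.
    by apply: funext => l; exact: p0.
  rewrite /free_act mmapE big1 // => w _.
  rewrite (_ : (fun=> 0) = fun l =>
      \sum_(i <- [::] : seq unit) (fun=> 0 : K) i * (fun=> v) i l).
    by rewrite word_act_lin big_nil mulr0.
  by apply: funext => l; rewrite big_nil.
- by rewrite free_actM p0.
Qed.

End Presentation.

(* The unused proof of n >= 2 lets this be an [algType K], which has to be    *)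
(* nontrivial (for n = 0 the presented algebra is zero).  On 'M[leavitt _]_d, *)
(* whose library scaling is by [leavitt], the K-scaling is                    *)
(* [in_alg (leavitt _) \; *:%R].                                              *)
Definition leavitt (K : fieldType) (n : nat) of (1 < n)%N :=
  {quot (@leavitt_ideal K n)}.

Section LeavittAlgebra.
Variables (K : fieldType) (n : nat) (n_ge2 : (1 < n)%N).

Local Notation L := (@leavitt K n n_ge2).
Local Notation F := (leavitt_free K n).
Local Notation I := (@leavitt_ideal K n).

HB.instance Definition _ := GRing.Zmodule.on L.

Definition leavitt_pi (p : F) : L := \pi_({quot I}) p.
Let lrepr (x : L) : F := repr (x : {quot I}).

Let reprK' x : leavitt_pi (lrepr x) = x.
Proof. exact: reprK. Qed.

Lemma leavitt_pi_eq p q : leavitt_pi p = leavitt_pi q <-> p - q \in I.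
Proof. by rewrite idealrBE; split => [/eqP|/eqP]. Qed.

Let leavitt_piD p q : leavitt_pi (p + q) = leavitt_pi p + leavitt_pi q.
Proof. exact: pi_addr. Qed.

Definition leavitt_mul (x y : L) : L := leavitt_pi (lrepr x * lrepr y).
Definition leavitt_scale (k : K) (x : L) : L := leavitt_pi (k *: lrepr x).

Let piM p q : leavitt_mul (leavitt_pi p) (leavitt_pi q) = leavitt_pi (p * q).
Proof.
rewrite /leavitt_mul; apply/leavitt_pi_eq; set p' := lrepr _; set q' := lrepr _.
have -> : p' * q' - p * q = (p' - p) * q' + p * (q' - q).
  by rewrite mulrBl mulrBr addrA subrK.
apply: rpredD; [apply: leavitt_ideal_mulr | apply: leavitt_ideal_mull];
  by apply/leavitt_pi_eq; rewrite reprK'.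
Qed.

Let piZ k p : leavitt_scale k (leavitt_pi p) = leavitt_pi (k *: p).
Proof.
rewrite /leavitt_scale; apply/leavitt_pi_eq; rewrite -scalerBr leavitt_ideal_scale //.
by apply/leavitt_pi_eq; rewrite reprK'.
Qed.

Let mulA : associative leavitt_mul.
Proof.
by move=> x y z; rewrite -[x]reprK' -[y]reprK' -[z]reprK' !piM mulrA.
Qed.
Let mul1 : left_id (leavitt_pi 1) leavitt_mul.
Proof. by move=> x; rewrite -[x]reprK' !piM mul1r. Qed.
Let mulx1 : right_id (leavitt_pi 1) leavitt_mul.
Proof. by move=> x; rewrite -[x]reprK' !piM mulr1. Qed.
Let mulDl : left_distributive leavitt_mul +%R.
Proof.
move=> x y z; rewrite -[x]reprK' -[y]reprK' -[z]reprK'.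
by rewrite -leavitt_piD !piM -leavitt_piD mulrDl.
Qed.
Let mulDr : right_distributive leavitt_mul +%R.
Proof.
move=> x y z; rewrite -[x]reprK' -[y]reprK' -[z]reprK'.
by rewrite -leavitt_piD !piM -leavitt_piD mulrDr.
Qed.
Let one_neq0 : leavitt_pi 1 != 0.
Proof.
apply/eqP => pi1; have /negP[] := leavitt_ideal1 K (ltnW n_ge2).
rewrite -[1]subr0; apply/leavitt_pi_eq; rewrite pi1; apply/esym.
exact: (raddf0 \pi_({quot I})).
Qed.

HB.instance Definition _ := GRing.Zmodule_isNzRing.Build L
  mulA mul1 mulx1 mulDl mulDr one_neq0.

Let scaleA k l x :
  leavitt_scale k (leavitt_scale l x) = leavitt_scale (k * l) x.
Proof. by rewrite -[x]reprK' !piZ scalerA. Qed.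
Let scale1 : left_id 1 leavitt_scale.
Proof. by move=> x; rewrite -[x]reprK' !piZ scale1r. Qed.
Let scaleDr : right_distributive leavitt_scale +%R.
Proof.
move=> k x y; rewrite -[x]reprK' -[y]reprK'.
by rewrite -leavitt_piD !piZ -leavitt_piD scalerDr.
Qed.
Let scaleDl x : {morph leavitt_scale^~ x : k l / k + l}.
Proof. by move=> k l; rewrite -[x]reprK' !piZ -leavitt_piD scalerDl. Qed.

HB.instance Definition _ := GRing.Zmodule_isLmodule.Build K L
  scaleA scale1 scaleDr scaleDl.

Let scaleAl k (x y : L) : k *: (x * y) = (k *: x) * y.
Proof.
rewrite -[x]reprK' -[y]reprK' [k *: leavitt_pi _]piZ.
by rewrite [_ * _ in LHS]piM [RHS]piM [LHS]piZ scalerAl.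
Qed.
HB.instance Definition _ := GRing.Lmodule_isLalgebra.Build K L scaleAl.

Let scaleAr k (x y : L) : k *: (x * y) = x * (k *: y).
Proof.
rewrite -[x]reprK' -[y]reprK' [k *: leavitt_pi (lrepr y)]piZ.
by rewrite [_ * _ in LHS]piM [RHS]piM [LHS]piZ free_scalerAr.
Qed.
HB.instance Definition _ := GRing.Lalgebra_isAlgebra.Build K L scaleAr.

Lemma leavitt_pi_is_zmod_morphism : zmod_morphism leavitt_pi.
Proof. exact: (raddfB \pi_({quot I})). Qed.
HB.instance Definition _ :=
  GRing.isZmodMorphism.Build F L leavitt_pi leavitt_pi_is_zmod_morphism.

Lemma leavitt_pi_is_monoid_morphism : monoid_morphism leavitt_pi.
Proof. by split=> // p q; rewrite [RHS]piM. Qed.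
HB.instance Definition _ :=
  GRing.isMonoidMorphism.Build F L leavitt_pi leavitt_pi_is_monoid_morphism.

Lemma leavitt_pi_is_scalable : scalable leavitt_pi.
Proof. by move=> k p; rewrite [RHS]piZ. Qed.
HB.instance Definition _ :=
  GRing.isScalable.Build K F L *:%R leavitt_pi leavitt_pi_is_scalable.

Definition leavitt_x (i : 'I_n) : L := leavitt_pi (free_x K i).
Definition leavitt_y (j : 'I_n) : L := leavitt_pi (free_y K j).

Lemma leavitt_xy i j : leavitt_x i * leavitt_y j = (i == j)%:R.
Proof.
rewrite -rmorphM -(rmorph_nat leavitt_pi); apply/leavitt_pi_eq/leavitt_idealP.
exact/span_gen/leavitt_rel_xy.
Qed.

Lemma leavitt_yx : \sum_(j < n) leavitt_y j * leavitt_x j = 1.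
Proof.
under eq_bigr => j _ do rewrite -rmorphM.
rewrite -rmorph_sum -(rmorph1 leavitt_pi); apply/leavitt_pi_eq/leavitt_idealP.
exact/span_gen/leavitt_rel_yx.
Qed.

End LeavittAlgebra.

(* Main.v *)
Require Import Defs.
From HB Require Import structures.
From mathcomp Require Import all_boot all_order all_algebra.
From mathcomp Require Import boolp zify.
From mathcomp.multinomials Require Import monalg.

Set Implicit Arguments.
Unset Strict Implicit.
Unset Printing Implicit Defensive.

Import GRing.Theory.
Import Quotient.

(* If: give [M_d(L)] the Leavitt generators read off a bijection between the
   [n d] leaves of a forest with [d] roots and [{1..n} x {1..d}].  The map
   [L -> M_d(L)] so obtained is injective because [L] is simple.  Call two nodes
   equivalent when the matrix unit between them lies in its image; the leaf
   numbered [t] is equivalent to root [t mod d].  The nodes fall into at most two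
   classes, traced on the roots by the rotation by [n - 1] modulo [d], and if
   these are balanced against the shape of the forest they merge, so that the
   image contains every matrix unit.

   Only if: let [E_ij] be [d x d] matrix units in [L], and let [F] be the span of
   the words in the [y_j], a free algebra in [L].  The right ideal
   [N = {a in F | E_ij a in F for all i, j}] of [F] has finite codimension [c],
   so that [N / sum_j N y_j] has dimension [1 + (n - 1) c]; as the [E_ij] act on
   this quotient, [d] divides [1 + (n - 1) c]. *)

(** * Colouring the leaves of a caterpillar *)

(** A multiset of Booleans is determined by its size and its number of [true]. So the two key lists
    are permutations of each other, and such a permutation lifts to [s]. *)
Lemma match_keys (T T' : eqType) (f : T -> bool) (g : T' -> bool) s t :
    size s = size t -> count f s = count g t ->
  exists2 s', perm_eq s' s & map f s' = map g t.
Proof.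
move=> st fg; have fgt : perm_eq (map g t) (map f s).
  have cb (l : seq bool) b :
      count_mem b l = if b then count id l else size l - count id l.
    case: b; first by apply: eq_count => -[].
    by rewrite -(count_predC id l) addKn; apply: eq_count => -[].
  by apply/allP => b _ /=; rewrite !cb !size_map !count_map st fg.
case: s => [|a s] in st fg fgt *.
  by exists [::] => //; case: t st {fg fgt}.
have [l lp ->] := perm_iotaP (f a) fgt.
exists (map (nth a (a :: s)) l).
  by apply/(perm_iotaP a); exists l => //; rewrite size_map in lp.
rewrite -map_comp; apply/eq_in_map => i.
rewrite (perm_mem lp) mem_iota add0n size_map => /andP[_ ilt].
by rewrite /= -(nth_map a (f a) f).
Qed.

(* [balanced D m t] holds when the staircase [t |-> ceil (t m / D)] jumps between
   [t] and [t + 1]; this set is periodic of period [D] and density [m / D]. *)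
Definition balanced D m t := (t.+1 * m).-1 %% D < m.

Lemma balanced_mod D m t : 0 < m -> balanced D m (t %% D) = balanced D m t.
Proof.
move=> m0; rewrite /balanced.
have -> : (t.+1 * m).-1 = ((t %% D).+1 * m).-1 + (t %/ D * m) * D.
  by rewrite {1}(divn_eq t D); nia.
by rewrite addnC modnMDl.
Qed.

(** The count telescopes: [(t * m + D.-1) %/ D] is the ceiling of [t m / D], which grows by one
    exactly at the balanced [t]. *)
Lemma count_balanced D m a b : 0 < m < D ->
  count (balanced D m) (iota a b) + (a * m + D.-1) %/ D =
  ((a + b) * m + D.-1) %/ D.
Proof.
move=> /andP[m0 mD]; elim: b a => [|b IH] a /=; first by rewrite addn0.
rewrite addnAC -addSnnS -IH addnC; congr (_ + _); rewrite /balanced.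
set N := (a.+1 * m).-1.
have -> : a.+1 * m + D.-1 = 1 * D + N by rewrite /N mulSn; lia.
have -> : a * m + D.-1 = N + (D - m) by rewrite /N mulSn; lia.
rewrite divnMDl; last lia.
have rD : N %% D < D by rewrite ltn_mod; lia.
have -> : N + (D - m) = N %/ D * D + (N %% D + (D - m)) by rewrite addnA -divn_eq.
rewrite divnMDl; last lia.
case: ltnP => hm; first by rewrite [(_ + _) %/ D]divn_small; lia.
have -> : N %% D + (D - m) = 1 * D + (N %% D - m) by lia.
by rewrite divnMDl ?[(_ - _) %/ D]divn_small; lia.
Qed.

Section Caterpillar.
Variables (n : nat) (i0 : 'I_n).

(** The leaves, as paths from the root, of the [n]-ary tree whose internal nodes are the words in
    [i0] alone of length below [k]. *)
Fixpoint caterpillar k : seq (seq 'I_n) :=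
  if k is k.+1 then
    [seq [:: i] | i <- enum 'I_n & i != i0] ++ map (cons i0) (caterpillar k)
  else [:: [::]].

(** With default [i0], prefixing [i0] never changes [last i0]. So each of the [k] levels contributes
    the letters other than [i0], and the tip of the spine contributes [i0]. *)
Lemma count_caterpillar (p : pred 'I_n) k :
  count (fun u => p (last i0 u)) (caterpillar k) =
  p i0 + k * count p [seq i <- enum 'I_n | i != i0].
Proof.
elim: k => [|k IH] /=; first by rewrite addn0.
by rewrite count_cat !count_map /= IH addnCA mulSn.
Qed.

Lemma size_caterpillar k : size (caterpillar k) = k * n.-1 + 1.
Proof.
elim: k => [|k IH] //=.
rewrite size_cat !size_map IH addnA mulSn; congr (_ + _ + _).
rewrite -[in RHS](card_ord n) -(cardC1 i0) cardE [enum (predC1 i0)]/enum_mem -enumT.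
by congr size; apply: eq_filter.
Qed.

Lemma caterpillar_uniq k : uniq (caterpillar k).
Proof.
elim: k => [|k IH] //=; rewrite cat_uniq.
have inj1 : injective (fun i : 'I_n => [:: i]) by move=> i j [].
have inj2 : injective (cons i0) by move=> u v [].
rewrite (map_inj_uniq inj1) (map_inj_uniq inj2) IH filter_uniq ?enum_uniq //.
rewrite andbT /=.
apply/hasPn => _ /mapP[u _ ->]; apply/mapP => -[i].
by rewrite mem_filter => /andP[/eqP ii0 _] [/esym].
Qed.

End Caterpillar.

(* Both sequences have [(d + 1) k + 1] entries coloured [true]. *)
Lemma coloured_caterpillar n (i0 : 'I_n) d m k : i0 = 0 :> nat -> 0 < m < d.+2 ->
    n.-1 * m = 1 + d.+2 * k ->
  exists2 s : seq (seq 'I_n), perm_eq s (caterpillar i0 d.+1) &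
    [seq balanced d.+2 m (last i0 u) | u <- s] =
    [seq balanced d.+2 m t | t <- iota (n + d) (d.+1 * n.-1 + 1)].
Proof.
move=> i00 mD mk; apply: match_keys; first by rewrite size_caterpillar size_iota.
have n0 : 0 < n by rewrite (leq_ltn_trans _ (ltn_ord i0)).
rewrite (count_caterpillar i0 (fun i => balanced d.+2 m i)).
have -> : [seq i <- enum 'I_n | i != i0] = behead (enum 'I_n).
  have := enum_uniq 'I_n; have := val_enum_ord n; case: (enum 'I_n) => [|j s] /=.
    by case: n n0 {i0 i00 mk}.
  rewrite -[in iota 0 n](prednK n0) => -[j0 _] /andP[js _].
  have -> : i0 = j by apply: ord_inj; rewrite i00 j0.
  rewrite eqxx /=; apply/all_filterP/allP => i; apply: contraTneq => ->.
  by [].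
have -> : count (fun i : 'I_n => balanced d.+2 m i) (behead (enum 'I_n)) =
    count (balanced d.+2 m) (iota 1 n.-1).
  have -> : iota 1 n.-1 = map (@nat_of_ord n) (behead (enum 'I_n)).
    by rewrite -behead_map val_enum_ord -[in RHS](prednK n0).
  by rewrite count_map.
have := count_balanced 1 n.-1 mD.
have := count_balanced (n + d) (d.+1 * n.-1 + 1) mD.
(* By [mk], each numerator is a multiple of [d.+2] plus a remainder below [d.+2], which gives the
   ceilings. The range from [1] has [k] coloured entries, and the range from [n + d] has
   [n m - (k + m) = 1 + (d + 1) k]. *)
have -> : n + d + (d.+1 * n.-1 + 1) = n * d.+2 by nia.
have -> : (n * d.+2) * m + d.+2.-1 = (n * m) * d.+2 + d.+1 by nia.
have -> : (n + d) * m + d.+2.-1 = (k + m) * d.+2 + (d.+2 - m) by nia.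
have -> : (1 + n.-1) * m + d.+2.-1 = k.+1 * d.+2 + m by nia.
have -> : 1 * m + d.+2.-1 = 1 * d.+2 + m.-1 by nia.
have [m0 mD'] := andP mD.
rewrite !divnMDl // !divn_small; try lia.
have -> : balanced d.+2 m i0 by rewrite i00 /balanced mul1n modn_small; lia.
set c1 := count _ _; set c2 := count _ _ => h1 h2.
rewrite /=; nia.
Qed.
Local Open Scope ring_scope.

(** * Bases of a subspace modulo another one *)

Lemma big_option (V : nmodType) (T : finType) (F : option T -> V) :
  \sum_t F t = F None + \sum_t F (Some t).
Proof.
rewrite (bigD1 None) //=; congr (_ + _).
rewrite (reindex_omap Some id) => [|[]//] /=.
by apply: eq_bigl => t; rewrite eqxx.
Qed.

Lemma sum_prod (V : nmodType) (T T' : finType) (F : T * T' -> V) :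
  \sum_t F t = \sum_i \sum_j F (i, j).
Proof. by rewrite pair_bigA; apply: eq_bigr => -[]. Qed.

Section BasisModulo.
Variables (K : fieldType) (V : lmodType K).
Implicit Types (S B N : V -> Prop) (T : finType).

Definition subspace S := S 0 /\ forall k a b, S a -> S b -> S (k *: a + b).

Lemma subspaceD S a b : subspace S -> S a -> S b -> S (a + b).
Proof. by case=> _ lS Sa Sb; rewrite -[a]scale1r; apply: lS. Qed.

Lemma subspaceZ S k a : subspace S -> S a -> S (k *: a).
Proof. by case=> S0 lS Sa; rewrite -[k *: a]addr0; apply: lS. Qed.

Lemma subspaceB S a b : subspace S -> S a -> S b -> S (a - b).
Proof.
by move=> sS Sa Sb; apply: subspaceD => //; rewrite -scaleN1r; apply: subspaceZ.
Qed.

Lemma subspace_sum S (I : Type) (r : seq I) (P : pred I) (f : I -> V) :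
  subspace S -> (forall i, P i -> S (f i)) -> S (\sum_(i <- r | P i) f i).
Proof.
by move=> sS Sf; apply: big_ind => //; [case: sS | move=> a b; apply: subspaceD].
Qed.

(** Linear algebra in the quotient of [S] by [B] is carried out on representatives, with congruences
    modulo [B] in place of equalities. *)
Definition span_mod S B T (b : T -> V) :=
  forall a, S a -> exists v : T -> K, B (a - \sum_t v t *: b t).

Definition free_mod B T (b : T -> V) :=
  forall v : T -> K, B (\sum_t v t *: b t) -> forall t, v t = 0.

Definition basis_mod S B T (b : T -> V) :=
  [/\ forall t, S (b t), span_mod S B b & free_mod B b].

(** Steinitz by rank: writing the [c t] in terms of [b] modulo [B] gives a matrix. A left kernel
    vector yields a combination of the [c t] in [B], hence vanishes, so the rows number at most the
    columns. *)
Lemma leq_free_span S B T T' (b : T -> V) (c : T' -> V) : subspace B ->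
  span_mod S B b -> (forall t, S (c t)) -> free_mod B c -> (#|T'| <= #|T|)%N.
Proof.
move=> sB spb Sc frc.
have [A hA] := choice (fun t => spb _ (Sc t)).
pose M := \matrix_(i < #|T'|, j < #|T|) A (enum_val i) (enum_val j).
suff /eqP <- : row_free M by apply: rank_leq_col.
rewrite -kermx_eq0; apply/eqP/row_matrixP => i; rewrite row0.
set u := row i _; have uM : u *m M = 0 by rewrite -row_mul mulmx_ker row0.
suff fr : forall t, u 0 (enum_rank t) = 0.
  by apply/rowP => j; rewrite -(enum_valK j) fr mxE.
apply: frc; have -> : \sum_t u 0 (enum_rank t) *: c t =
  \sum_t u 0 (enum_rank t) *: (c t - \sum_s A t s *: b s).
  under [RHS]eq_bigr => t _ do rewrite scalerBr scaler_sumr.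
  rewrite sumrB exchange_big /= [X in _ - X]big1 ?subr0 // => s _.
  under eq_bigr => t _ do rewrite scalerA.
  rewrite -scaler_suml (_ : \sum_t _ = 0) ?scale0r //.
  have /rowP/(_ (enum_rank s)) := uM; rewrite !mxE; apply: etrans.
  rewrite [RHS](reindex enum_rank) /=; last first.
    by exists enum_val => t _; rewrite ?enum_valK ?enum_rankK.
  by apply: eq_bigr => t _; rewrite [M _ _]mxE !enum_rankK.
by apply: subspace_sum => // t _; apply: subspaceZ.
Qed.

Lemma card_basis_mod S B T T' (b : T -> V) (c : T' -> V) : subspace B ->
  basis_mod S B b -> basis_mod S B c -> #|T| = #|T'|.
Proof.
move=> sB [Sb spb frb] [Sc spc frc]; apply/eqP; rewrite eqn_leq.
by rewrite (leq_free_span sB spc Sb frb) (leq_free_span sB spb Sc frc).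
Qed.

(** A free family of maximal size spans, since an element outside its span could be added to it. *)
Lemma exists_basis_mod S B D : subspace S -> subspace B ->
    (forall m (c : 'I_m -> V), (forall i, S (c i)) -> free_mod B c -> (m <= D)%N) ->
  exists m (b : 'I_m -> V), basis_mod S B b.
Proof.
move=> sS sB bound.
pose P m := `[< exists2 c : 'I_m -> V, forall i, S (c i) & free_mod B c >].
have exP : exists m, P m.
  exists 0; apply/asboolP; exists (fun=> 0); first by case.
  by move=> v _ [].
have ubP m : P m -> (m <= D)%N by move/asboolP => -[c Sc frc]; apply: bound frc.
case: (ex_maxnP exP ubP) => m /asboolP[b Sb frb] maxm.
exists m, b; split=> // a Sa.
have [//|nsp] := pselect (exists v : 'I_m -> K, B (a - \sum_t v t *: b t)).
suff /maxm : P m.+1 by rewrite ltnn.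
apply/asboolP; pose c (i : 'I_m.+1) := oapp b a (unlift ord0 i).
exists c => [i|v]; first by rewrite /c; case: (unlift ord0 i) => [j|] /=.
have c0 : c ord0 = a by rewrite /c unlift_none.
have cS i : c (lift ord0 i) = b i by rewrite /c liftK.
rewrite big_ord_recl c0; under eq_bigr => i _ do rewrite cS.
move=> Bv; have v0 : v ord0 = 0.
  apply: contrapT => /eqP v0; apply: nsp.
  (* A nonzero coefficient of [a] in the relation would let it be solved for [a], against [nsp]. *)
  exists (fun i => - (v ord0)^-1 * v (lift ord0 i)).
  rewrite -[a]scale1r -(mulVf v0) -scalerA.
  under eq_bigr => i _ do rewrite mulNr scaleNr -scalerA.
  by rewrite sumrN opprK -scaler_sumr -scalerDr; apply: subspaceZ.
move: Bv; rewrite v0 scale0r add0r => Bv t.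
by case: (unliftP ord0 t) => [j|] -> //; apply: (frb (fun i => v (lift ord0 i))).
Qed.

Lemma basis_mod_trans S N B T T' (b : T -> V) (c : T' -> V) :
    subspace B -> subspace N ->
    (forall a, N a -> S a) -> (forall a, B a -> N a) ->
    basis_mod S N b -> basis_mod N B c ->
  basis_mod S B (fun t : T + T' => match t with inl t => b t | inr t => c t end).
Proof.
move=> sB sN NS BN [Sb spb frb] [Nc spc frc]; split.
- by case=> t //; apply: NS.
- move=> a /spb[v /spc[w Bw]].
  exists (fun t => match t with inl t => v t | inr t => w t end).
  by rewrite big_sumType opprD addrA.
move=> v; rewrite big_sumType /= => Bv.
have Nr : N (\sum_t v (inr t) *: c t).
  by apply: subspace_sum => // t _; apply: subspaceZ.
have v0 : forall t, v (inl t) = 0.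
  apply: (frb (fun t => v (inl t))).
  have := subspaceB sN (BN _ Bv) Nr.
  by rewrite addrK.
case=> t //; apply: (frc (fun t => v (inr t))).
by move: Bv; rewrite big1 ?add0r // => s _; rewrite v0 scale0r.
Qed.

End BasisModulo.
(** * Polynomials in the y_j *)

Section LeavittFamily.
Variables (K : fieldType) (L : algType K) (n : nat) (x y : 'I_n -> L).
Hypothesis n_ge2 : (1 < n)%N.
Hypothesis xy : forall i j, x i * y j = (i == j)%:R.
Hypothesis yx : \sum_j y j * x j = 1.
(** The words in the [x i] and [y j] span [L], stated as an induction on the last letter. *)
Hypothesis gen : forall P : L -> Prop, subspace P -> P 1 ->
  (forall a i, P a -> P (a * x i)) -> (forall a j, P a -> P (a * y j)) ->
  forall a, P a.

Let i0 : 'I_n := Ordinal (ltnW n_ge2).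
Let i1 : 'I_n := Ordinal n_ge2.

Lemma sum_xy (f : 'I_n -> L) i : \sum_j x i * (y j * f j) = f i.
Proof.
rewrite (bigD1 i) //= mulrA xy eqxx mul1r big1 ?addr0 // => j /negPf ji.
by rewrite mulrA xy eq_sym ji mul0r.
Qed.

(** Polynomials in the [y i] of degree below [m], split into a constant and the cofactors of the
    first letter. *)
Fixpoint ydeg m (f : L) : Prop := match m with
  | 0 => f = 0
  | m.+1 => exists (c : K) g, f = c%:A + \sum_i y i * g i /\ forall i, ydeg m (g i)
  end.

Lemma ydegSE m f : ydeg m.+1 f <->
  exists (c : K) g, f = c%:A + \sum_i y i * g i /\ forall i, ydeg m (g i).
Proof. by []. Qed.

Definition ypoly f := exists m, ydeg m f.

Lemma ydeg_subspace m : subspace (ydeg m).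
Proof.
elim: m => [|m [IH0 IH]]; split=> //=.
- by move=> k a b -> ->; rewrite scaler0 addr0.
- exists 0, (fun=> 0); split=> //.
  by rewrite scale0r add0r big1 // => i _; rewrite mulr0.
move=> k _ _ /ydegSE[c [g [-> dg]]] /ydegSE[c' [g' [-> dg']]].
exists (k * c + c'), (fun i => k *: g i + g' i); split; last by move=> i; apply: IH.
under [in RHS]eq_bigr => i _ do rewrite mulrDr -scalerAr.
by rewrite big_split /= -scaler_sumr scalerDl -scalerA scalerDr addrACA.
Qed.

Lemma ydegS m f : ydeg m f -> ydeg m.+1 f.
Proof.
elim: m f => [|m IH] f; first by move=> ->; apply: (ydeg_subspace 1).1.
by case/ydegSE=> c [g [-> dg]]; exists c, g; split=> // i; apply: IH.
Qed.

Lemma ydeg_leq m m' f : (m <= m')%N -> ydeg m f -> ydeg m' f.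
Proof. by move=> /subnK <- df; elim: (m' - m)%N => // k; apply: ydegS. Qed.

Lemma ypoly_subspace : subspace ypoly.
Proof.
split=> [|k a b [m da] [m' db]]; first by exists 0%N.
exists (maxn m m'); apply: (ydeg_subspace _).2.
  by apply: ydeg_leq da; apply: leq_maxl.
by apply: ydeg_leq db; apply: leq_maxr.
Qed.

Lemma ypoly_deg (g : 'I_n -> L) :
  (forall i, ypoly (g i)) -> exists m, forall i, ydeg m (g i).
Proof.
move=> /choice[e de]; exists (\max_i e i) => i.
by apply: ydeg_leq (de i); apply: (leq_bigmax i).
Qed.

Lemma ypolyE f : ypoly f <->
  exists (c : K) g, f = c%:A + \sum_i y i * g i /\ forall i, ypoly (g i).
Proof.
split=> [[[|m]]|[c [g [-> /ypoly_deg[m dg]]]]]; last by exists m.+1, c, g.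
  move=> /= ->; exists 0, (fun=> 0); split=> [|i]; last by exists 0%N.
  by rewrite scale0r add0r big1 // => i _; rewrite mulr0.
by case/ydegSE=> c [g [-> dg]]; exists c, g; split=> // i; exists m.
Qed.

Lemma ypoly_ind (P : L -> Prop) : subspace P -> P 1 ->
  (forall i f, P f -> P (y i * f)) -> forall f, ypoly f -> P f.
Proof.
move=> sP P1 Py f [m]; elim: m f => [|m IH] f; first by move=> ->; apply: sP.1.
case/ydegSE=> c [g [-> dg]]; apply: sP.2 => //.
by apply: subspace_sum => // i _; apply: Py; apply: IH.
Qed.

Lemma ypoly1 : ypoly 1.
Proof.
apply/ypolyE; exists 1, (fun=> 0); split=> [|i]; last by exists 0%N.
by rewrite scale1r big1 ?addr0 // => i _; rewrite mulr0.
Qed.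

Lemma ypoly_y i f : ypoly f -> ypoly (y i * f).
Proof.
move=> Ff; apply/ypolyE; exists 0, (fun j => if j == i then f else 0).
split=> [|j]; last by case: eqP => // _; exists 0%N.
rewrite scale0r add0r (bigD1 i) //= eqxx big1 ?addr0 // => j /negPf ->.
by rewrite mulr0.
Qed.

Lemma ypolyM f g : ypoly f -> ypoly g -> ypoly (f * g).
Proof.
move=> Ff Fg; move: f Ff; apply: ypoly_ind; last 1 first.
- by move=> i f; rewrite -mulrA; apply: ypoly_y.
- split=> [|k a b Fa Fb]; first by rewrite mul0r; exists 0%N.
  by rewrite mulrDl -scalerAl; apply: ypoly_subspace.2.
by rewrite mul1r.
Qed.

Lemma ypoly_right f : ypoly f ->
  exists (c : K) g, f = c%:A + \sum_i g i * y i /\ forall i, ypoly (g i).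
Proof.
have F0 : ypoly 0 := ypoly_subspace.1.
move: f; apply: ypoly_ind.
- split=> [|k _ _ [c [g [-> dg]]] [c' [g' [-> dg']]]].
    exists 0, (fun=> 0); split=> //.
    by rewrite scale0r add0r big1 // => i _; rewrite mul0r.
  exists (k * c + c'), (fun i => k *: g i + g' i).
  split; last by move=> i; apply: ypoly_subspace.2.
  under [in RHS]eq_bigr => i _ do rewrite mulrDl -scalerAl.
  by rewrite big_split /= -scaler_sumr scalerDl -scalerA scalerDr addrACA.
- exists 1, (fun=> 0); split=> //.
  by rewrite scale1r big1 ?addr0 // => i _; rewrite mul0r.
move=> i _ [c [g [-> dg]]].
(* The constant [c], once multiplied by [y i], becomes a contribution to the cofactor of the last
   letter [y i]. *)
exists 0, (fun j => (c *+ (j == i))%:A + y i * g j); split=> [|j]; last first.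
  by apply: subspaceD; [apply: ypoly_subspace | | apply: ypoly_y];
    rewrite //; apply: subspaceZ ypoly1; apply: ypoly_subspace.
rewrite scale0r add0r mulrDr mulr_sumr.
under [in RHS]eq_bigr => j _ do rewrite mulrDl -scalerAl mul1r -mulrA.
rewrite big_split /=; congr (_ + _).
rewrite (bigD1 i) //= eqxx big1 ?addr0 ?mulr1n -?scalerAr ?mulr1 //.
by move=> j /negPf ->; rewrite mulr0n scale0r.
Qed.

(* The word [y_0^a y_1] is not a prefix of [v y_0^b y_1] when [v] is nonempty and
   short compared to [a <= b], so sandwiching between such words and their duals
   isolates the constant term of a polynomial in the [y_j]. *)
Definition constant_term f (c : K) := exists k, forall a b, (k <= a <= b)%N ->
  x i1 * x i0 ^+ a * f * (y i0 ^+ b * y i1) = (c *+ (a == b))%:A.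

Lemma xpow_ypow i a b : x i ^+ (a + b) * y i ^+ b = x i ^+ a.
Proof.
elim: b => [|b IH]; first by rewrite addn0 mulr1.
by rewrite addnS exprSr exprS mulrA -(mulrA _ (x i)) xy eqxx mulr1.
Qed.

Lemma constant_term_uniq f c c' :
  constant_term f c -> constant_term f c' -> c = c'.
Proof.
move=> [k hk] [k' hk']; apply: (fmorph_inj (GRing.in_alg L)).
pose a := maxn k k'; move: (hk a a) (hk' a a).
rewrite leqnn leq_maxl leq_maxr eqxx !mulr1n => /(_ isT) e /(_ isT) e'.
exact: etrans (esym e) e'.
Qed.

Lemma constant_term_lin k f c g c' : constant_term f c -> constant_term g c' ->
  constant_term (k *: f + g) (k * c + c').
Proof.
move=> [e he] [e' he']; exists (maxn e e') => a b.
rewrite geq_max => /andP[/andP[ea ea'] ab].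
rewrite mulrDr mulrDl -scalerAr -scalerAl he ?he' ?ea ?ea' //.
by rewrite mulrnDl scalerDl -mulrnAr scalerA.
Qed.

Lemma constant_term1 : constant_term 1 1.
Proof.
exists 0%N => a b /andP[_ ab]; rewrite mulr1 -(subnK ab) addnC.
(* The powers cancel to leave [y i0 ^+ (b - a)] between [x i1] and [y i1], which gives zero as soon
   as [a < b]. *)
have -> : x i1 * x i0 ^+ a * (y i0 ^+ (a + (b - a)) * y i1) =
          x i1 * (y i0 ^+ (b - a) * y i1).
  rewrite exprD !mulrA -(mulrA (x i1) (x i0 ^+ a)).
  by rewrite -[in x i0 ^+ a](add0n a) xpow_ypow mulr1.
case: (b - a)%N => [|e].
  by rewrite addn0 eqxx mulr1n scale1r mul1r xy eqxx.
rewrite exprS !mulrA xy (_ : i1 == i0 = false) // !mul0r.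
by rewrite -[X in X == _]addn0 eqn_add2l mulr0n scale0r.
Qed.

Lemma constant_term_y i f c : constant_term f c -> constant_term (y i * f) 0.
Proof.
(* If [i = i0], one factor [x i0] cancels against [y i]. The remaining exponents satisfy [a < b],
   where the sandwich of [f] vanishes; the bound rises by one to pay for the lost factor. *)
move=> [k hk]; exists k.+1 => -[|a] b //; rewrite ltnS => /andP[ka ab].
rewrite mul0rn scale0r exprSr !mulrA -(mulrA _ (x i0)) xy.
case: eqP => [_|_]; last by rewrite mulr0 !mul0r.
rewrite mulr1; move: (hk a b).
by rewrite ka (ltnW ab) (ltn_eqF ab) mulr0n scale0r !mulrA => ->.
Qed.

Lemma constant_term0 : constant_term 0 0.
Proof.
by exists 0%N => a b _; rewrite mulr0 mul0r mul0rn scale0r.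
Qed.

Lemma ypoly_constant f : ypoly f -> exists c, constant_term f c.
Proof.
move: f; apply: ypoly_ind.
- split=> [|k f g [c fc] [c' gc]]; first by exists 0; apply: constant_term0.
  by exists (k * c + c'); apply: constant_term_lin.
- by exists 1; apply: constant_term1.
by move=> i f [c /constant_term_y]; exists 0.
Qed.

Lemma constant_term_yr f j : ypoly f -> constant_term (f * y j) 0.
Proof.
move: f; apply: ypoly_ind => [||i f fc].
- split=> [|k f g fc gc]; first by rewrite mul0r; apply: constant_term0.
  have := constant_term_lin k fc gc.
  by rewrite mulr0 addr0 mulrDl -scalerAl.
- by rewrite mul1r -[y j]mulr1; apply: constant_term_y constant_term1.
by rewrite -mulrA; apply: constant_term_y fc.
Qed.

Lemma constant_term_sum (I : finType) (f : I -> L) :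
  (forall i, constant_term (f i) 0) -> constant_term (\sum_i f i) 0.
Proof.
move=> fc; apply: (big_ind (constant_term^~ 0)) => //; first exact: constant_term0.
move=> a b ac bc; have := constant_term_lin 1 ac bc.
by rewrite scale1r mulr0 addr0.
Qed.

Lemma constant_termC c f :
  constant_term f 0 -> constant_term (c%:A + f) c.
Proof.
by move=> /(constant_term_lin c constant_term1); rewrite mulr1 addr0.
Qed.

Lemma ypoly_right_const c g : (forall j, ypoly (g j)) ->
  c%:A + \sum_j g j * y j = 0 -> c = 0 /\ \sum_j g j * y j = 0.
Proof.
move=> Fg cg; suff c0 : c = 0.
  by split=> //; move: cg; rewrite c0 scale0r add0r.
apply: (@constant_term_uniq (c%:A + \sum_j g j * y j)).
  apply: constant_termC; apply: constant_term_sum => j.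
  exact: constant_term_yr (Fg j).
by rewrite cg; apply: constant_term0.
Qed.

(** Multiplying the relation by [x i] removes the first letter: with [g j = c j + sum_i y i * h j i]
    it becomes [c i + sum_j h j i * y j = 0]. Constant terms give [c i = 0], and the [h j i] have
    smaller degree. *)
Lemma ydeg_right_free m g :
  (forall j, ydeg m (g j)) -> \sum_j g j * y j = 0 -> forall j, g j = 0.
Proof.
elim: m g => [//|m IH] g dg g0.
have /choice[c /choice[h hg]] j := (ydegSE _ _).1 (dg j).
have Fh j i : ypoly (h j i) by exists m; apply: (hg j).2.
have xg i : (c i)%:A + \sum_j h j i * y j = 0.
  have : x i * (\sum_j g j * y j) = 0 by rewrite g0 mulr0.
  apply: etrans; rewrite mulr_sumr.
  have -> : (c i)%:A = \sum_j (c j *+ (i == j))%:A :> L.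
    rewrite (bigD1 i) //= eqxx big1 ?addr0 // => j /negPf.
    by rewrite eq_sym => ->; rewrite mulr0n scale0r.
  rewrite -big_split /=; apply: eq_bigr => j _.
  rewrite (hg j).1 mulrDl mulrDr mulr_suml mulr_sumr; congr (_ + _).
    rewrite -scalerAl mul1r -scalerAr xy.
    by case: (i == j); rewrite ?mulr1n ?mulr0n ?scale0r ?scaler0.
  under eq_bigr => k _ do rewrite -mulrA.
  by rewrite (sum_xy (fun k => h j k * y j)).
have hc i : c i = 0 /\ \sum_j h j i * y j = 0.
  by apply: ypoly_right_const (xg i) => j; apply: Fh.
have h0 i j : h j i = 0 by apply: (IH (fun j => h j i)) (hc i).2 j => j; apply: (hg j).2.
move=> j; rewrite (hg j).1 (hc j).1 scale0r add0r big1 // => i _.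
by rewrite h0 mulr0.
Qed.

Lemma ypoly_right_free c g : (forall j, ypoly (g j)) ->
  c%:A + \sum_j g j * y j = 0 -> c = 0 /\ forall j, g j = 0.
Proof.
move=> Fg /(ypoly_right_const Fg)[-> g0]; split=> //.
by have [m dg] := ypoly_deg Fg; apply: ydeg_right_free dg g0.
Qed.

(** Multiplication by suitable [x i] strips first letters until the constant term is nonzero; the
    sandwich of [constant_term] then isolates it. *)
Lemma ypoly_unit (f : L) : ypoly f -> f != 0 -> exists p r, p * f * r = 1.
Proof.
case=> m; elim: m f => [|m IH] f; first by move=> ->; rewrite eqxx.
case/ydegSE=> c [g [-> dg]]; have [->|c0 _] := eqVneq c 0.
  rewrite scale0r add0r => s0.
  have [i gi0] : exists i, g i != 0.
    apply: contrapT => /forallNP g0; move/eqP: s0; apply; apply: big1 => i _.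
    by have /negP := g0 i; rewrite negbK => /eqP ->; rewrite mulr0.
  have [p [r pr]] := IH _ (dg i) gi0; exists (p * x i), r.
  by rewrite -(mulrA p) mulr_sumr sum_xy.
have [k] : constant_term (c%:A + \sum_i y i * g i) c.
  apply: constant_termC; apply: constant_term_sum => i.
  have [|e] := @ypoly_constant (g i); first by exists m.
  exact: constant_term_y.
move=> /(_ k k); rewrite leqnn eqxx mulr1n => /(_ isT) hk.
exists (c^-1 *: (x i1 * x i0 ^+ k)), (y i0 ^+ k * y i1).
by rewrite -!scalerAl hk scalerA mulVf // scale1r.
Qed.

(** The combinations of words in the [y i] of length at least [k]. *)
Fixpoint ytail k (f : L) : Prop := match k with
  | 0 => ypoly f
  | k.+1 => exists2 g : 'I_n -> L, f = \sum_i y i * g i & forall i, ytail k (g i)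
  end.

Lemma ytailSE k f : ytail k.+1 f <->
  exists2 g : 'I_n -> L, f = \sum_i y i * g i & forall i, ytail k (g i).
Proof. by []. Qed.

Lemma ytail_subspace k : subspace (ytail k).
Proof.
elim: k => [|k [IH0 IH]]; first exact: ypoly_subspace.
split=> [|c _ _ /ytailSE[g -> tg] /ytailSE[g' -> tg']].
  by exists (fun=> 0); rewrite // big1 // => i _; rewrite mulr0.
exists (fun i => c *: g i + g' i); last by move=> i; apply: IH.
under [in RHS]eq_bigr => i _ do rewrite mulrDr -scalerAr.
by rewrite big_split /= -scaler_sumr.
Qed.

Lemma ytailS k f : ytail k.+1 f -> ytail k f.
Proof.
elim: k f => [|k IH] f; last by case/ytailSE=> g -> tg; exists g => // i; apply: IH.
case/ytailSE=> g -> tg; apply: subspace_sum; first exact: ypoly_subspace.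
by move=> i _; apply: ypoly_y; apply: tg.
Qed.

Lemma ytail_leq k k' f : (k <= k')%N -> ytail k' f -> ytail k f.
Proof. by move=> /subnK <-; elim: (k' - k)%N => // m IH /ytailS. Qed.

Lemma ytail_y k i f : ytail k f -> ytail k.+1 (y i * f).
Proof.
move=> tf; exists (fun j => if j == i then f else 0) => [|j].
  by rewrite (bigD1 i) //= eqxx big1 ?addr0 // => j /negPf ->; rewrite mulr0.
by case: eqP => // _; apply: (ytail_subspace k).1.
Qed.

(** Each letter [x i] of [a] consumes one leading [y], so [k] need only bound the number of letters
    [x] in the words of [a]. *)
Lemma ytail_denominator (a : L) : exists k, forall g, ytail k g -> ypoly (a * g).
Proof.
move: a; apply: gen.
- split=> [|c a b [k ka] [k' kb]].
    by exists 0%N => g _; rewrite mul0r; apply: ypoly_subspace.1.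
  exists (maxn k k') => g tg; rewrite mulrDl -scalerAl.
  apply: ypoly_subspace.2; [apply: ka | apply: kb]; apply: ytail_leq tg.
    exact: leq_maxl.
  exact: leq_maxr.
- by exists 0%N => g; rewrite mul1r.
- move=> a i [k ka]; exists k.+1 => _ /ytailSE[g -> tg]; rewrite -mulrA mulr_sumr sum_xy.
  exact: ka.
by move=> a j [k ka]; exists k => g /(ytail_y j)/ytailS tg; rewrite -mulrA; apply: ka.
Qed.

(** By [yx], an element that kills every [y j] on its right is zero; this is iterated [k] times. *)
Lemma ytail_eq0 k (a : L) : (forall g, ytail k g -> a * g = 0) -> a = 0.
Proof.
elim: k a => [|k IH] a a0; first by rewrite -[a]mulr1 a0 //; apply: ypoly1.
rewrite -[a]mulr1 -yx mulr_sumr big1 // => j _; rewrite mulrA.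
by rewrite [a * _]IH ?mul0r // => g tg; rewrite -mulrA a0 //; apply: ytail_y.
Qed.

(** Some multiple [a * g] is a nonzero polynomial in the [y j], and [ypoly_unit] applies to it. *)
Lemma leavitt_family_simple (a : L) : a != 0 -> exists p r, p * a * r = 1.
Proof.
move=> a0; have [k ka] := ytail_denominator a.
have [g tg ag0] : exists2 g, ytail k g & a * g != 0.
  apply: contrapT => /forall2NP nt; move/eqP: a0; apply.
  apply: (@ytail_eq0 k) => g tg; apply/eqP; apply: contraT => ag.
  by case: (nt g).
have [p [r pr]] := ypoly_unit (ka _ tg) ag0.
by exists p, (g * r); rewrite mulrA -(mulrA p).
Qed.

(** The words of length below [k] span: [None] stands for the empty word, and a pair for a first
    letter followed by a shorter word. *)
Lemma ytail_cofinite k :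
  exists (T : finType) (b : T -> L), span_mod ypoly (ytail k) b.
Proof.
elim: k => [|k [T [b spb]]].
  exists void, (fun=> 0) => a Fa; exists (fun=> 0).
  by rewrite big1 ?subr0 // => -[].
exists (option ('I_n * T)%type), (oapp (fun t => y t.1 * b t.2) 1).
move=> _ /ypolyE[c [g [-> Fg]]].
have /choice[v hv] := fun i => spb _ (Fg i).
exists (oapp (fun t => v t.1 t.2) c).
rewrite big_option /= opprD addrACA subrr add0r.
rewrite sum_prod /= -sumrB.
exists (fun i => g i - \sum_t v i t *: b t) => //.
apply: eq_bigr => i _; rewrite mulrBr mulr_sumr; congr (_ - _).
by apply: eq_bigr => t _; rewrite scalerAr.
Qed.

(** * Matrix units in a Leavitt algebra *)

Section MatrixUnits.
Variables (d : nat) (E : 'I_d.+1 -> 'I_d.+1 -> L).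
Hypothesis EE : forall i j k l, E i j * E k l = E i l *+ (j == k).
Hypothesis sumE : \sum_i E i i = 1.

Let N a := ypoly a /\ forall i j, ypoly (E i j * a).
Let B a := exists2 g : 'I_n -> L, a = \sum_j g j * y j & forall j, N (g j).

Let N_subspace : subspace N.
Proof.
split=> [|c a b [Fa Ea] [Fb Eb]].
  by split=> [|i j]; rewrite ?mulr0; apply: ypoly_subspace.1.
split=> [|i j]; first exact: ypoly_subspace.2.
by rewrite mulrDr -scalerAr; apply: ypoly_subspace.2.
Qed.

Let N_right a j : N a -> N (a * y j).
Proof.
have Fy : ypoly (y j) by rewrite -[y j]mulr1; apply/ypoly_y/ypoly1.
case=> Fa Ea; split=> [|i k]; first exact: ypolyM.
by rewrite mulrA; apply: ypolyM.
Qed.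

Let N_left i j a : N a -> N (E i j * a).
Proof.
case=> Fa Ea; split=> // k l; rewrite mulrA EE.
by case: eqP => _; rewrite ?mulr1n // mulr0n mul0r; apply: ypoly_subspace.1.
Qed.

Let B_subspace : subspace B.
Proof.
split=> [|c _ _ [g -> Ng] [h -> Nh]].
  exists (fun=> 0) => [|j]; last exact: N_subspace.1.
  by rewrite big1 // => j _; rewrite mul0r.
exists (fun j => c *: g j + h j) => [|j]; last exact: N_subspace.2.
under [RHS]eq_bigr => j _ do rewrite mulrDl -scalerAl.
by rewrite big_split /= -scaler_sumr.
Qed.

Let BN a : B a -> N a.
Proof.
by case=> g -> Ng; apply: subspace_sum => // j _; apply: N_right.
Qed.

Let B_left i j a : B a -> B (E i j * a).
Proof.
case=> g -> Ng; exists (fun k => E i j * g k) => [|k]; last exact: N_left.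
by rewrite mulr_sumr; apply: eq_bigr => k _; rewrite mulrA.
Qed.

(** [N] contains [ytail k] for [k] the largest of the denominators of the finitely many [E i j]. *)
Let N_cofinite : exists m (b : 'I_m -> L), basis_mod ypoly N b.
Proof.
have /choice[k hk] := fun p : 'I_d.+1 * 'I_d.+1 => ytail_denominator (E p.1 p.2).
have tailN a : ytail (\max_p k p) a -> N a.
  move=> ta; split=> [|i j]; first exact: (@ytail_leq 0) ta.
  apply: (hk (i, j)); apply: ytail_leq ta.
  exact: (leq_bigmax (i, j)).
have [T [b spb]] := ytail_cofinite (\max_p k p).
apply: (exists_basis_mod (D := #|T|)) => [||m c Fc frc].
- exact: ypoly_subspace.
- exact: N_subspace.
rewrite -(card_ord m); apply: (leq_free_span (b := b) N_subspace) Fc frc.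
by move=> a /spb[v /tailN Nv]; exists v.
Qed.

(** A polynomial is uniquely a constant plus a sum of [g j * y j], so modulo [B] it amounts to a
    scalar and [n] classes modulo [N]. The dimension is thus [1 + n m]. *)
Let extend_basis m (b : 'I_m -> L) : basis_mod ypoly N b ->
  basis_mod ypoly B (oapp (fun t : 'I_m * 'I_n => b t.1 * y t.2) 1).
Proof.
case=> Fb spb frb; split.
- case=> [[t j]|] /=; last exact: ypoly1.
  by apply: ypolyM => //; rewrite -[y j]mulr1; apply/ypoly_y/ypoly1.
- move=> _ /ypoly_right[c [g [-> Fg]]].
  have /choice[v hv] := fun j => spb _ (Fg j).
  exists (oapp (fun t => v t.2 t.1) c).
  rewrite big_option /= opprD addrACA subrr add0r.
  rewrite sum_prod exchange_big /=.
  exists (fun j => g j - \sum_t v j t *: b t) => //.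
  rewrite -sumrB; apply: eq_bigr => j _; rewrite mulrBl mulr_suml.
  by under eq_bigr => t _ do rewrite scalerAl.
move=> v; rewrite big_option /=.
rewrite sum_prod exchange_big /=.
case=> g hg Ng.
(* The relation modulo [B] becomes an exact relation with cofactors [h j]; freeness makes these
   zero, which puts each combination of the [b t] in [N]. *)
pose h j := \sum_t v (Some (t, j)) *: b t - g j.
have Fh j : ypoly (h j).
  apply: subspaceB; [exact: ypoly_subspace | | exact: (Ng j).1].
  apply: subspace_sum; first exact: ypoly_subspace.
  by move=> t _; apply: subspaceZ (Fb t); apply: ypoly_subspace.
have [|v0 h0] := @ypoly_right_free (v None) h Fh.
  have -> : \sum_j h j * y j =
      \sum_j \sum_t v (Some (t, j)) *: (b t * y j) - \sum_j g j * y j.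
    rewrite -sumrB; apply: eq_bigr => j _; rewrite mulrBl mulr_suml.
    by under eq_bigr => t _ do rewrite -scalerAl.
  by rewrite addrA hg subrr.
case=> [[t j]|] //; apply: (frb (fun t => v (Some (t, j)))).
by have /eqP := h0 j; rewrite subr_eq0 => /eqP ->.
Qed.

Let S a := N a /\ E ord0 ord0 * a = a.

(** [N] is the direct sum of the [E i i * N], and [E i ord0] carries the corner [S] onto the [i]-th
    summand compatibly with [B]. *)
Let split_basis r (b : 'I_r -> L) : basis_mod S B b ->
  basis_mod N B (fun t : 'I_d.+1 * 'I_r => E t.1 ord0 * b t.2).
Proof.
case=> Sb spb frb; split=> [[i t]|a Na|v] /=.
- by apply: N_left; apply: (Sb t).1.
- have SE i : S (E ord0 i * a).
    by split; [exact: N_left | rewrite mulrA EE eqxx].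
  have /choice[v hv] := fun i => spb _ (SE i).
  exists (fun t => v t.1 t.2).
  rewrite sum_prod /=.
  have -> : a = \sum_i E i ord0 * (E ord0 i * a).
    rewrite -{1}[a]mul1r -sumE mulr_suml.
    by apply: eq_bigr => i _; rewrite mulrA EE eqxx.
  rewrite -sumrB; apply: subspace_sum => // i _.
  under eq_bigr => t _ do rewrite scalerAr.
  by rewrite -mulr_sumr -mulrBr; apply: B_left.
rewrite sum_prod /= => Bv [j t].
apply: (frb (fun t => v (j, t))) t.
suff -> : \sum_t v (j, t) *: b t =
    E ord0 j * \sum_i \sum_t v (i, t) *: (E i ord0 * b t) by apply: B_left.
rewrite mulr_sumr (bigD1 j) //= [X in _ + X]big1 ?addr0 => [|i /negPf ij].
  rewrite mulr_sumr; apply: eq_bigr => t _.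
  by rewrite -scalerAr mulrA EE eqxx (Sb t).2.
rewrite mulr_sumr big1 // => t _.
by rewrite -scalerAr mulrA EE eq_sym ij mul0r scaler0.
Qed.

(** Both sides are the dimension of [ypoly] modulo [B], computed through the intermediate [N] and by
    [extend_basis]. *)
Lemma matrix_units_card : exists c r, (c + d.+1 * r = 1 + n * c)%N.
Proof.
have [c [b bb]] := N_cofinite; have bB := extend_basis bb.
have S_subspace : subspace S.
  split=> [|k a a' [Na Ea] [Na' Ea']].
    by split; [exact: N_subspace.1 | rewrite mulr0].
  by split; [exact: N_subspace.2 | rewrite mulrDr -scalerAr Ea Ea'].
(* Since [S] lies in [ypoly], its free families modulo [B] are bounded by the finite dimension of
   [ypoly] modulo [B]. *)
have [|r [e be]] := @exists_basis_mod _ _ S B #|{: option ('I_c * 'I_n)}|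
    S_subspace B_subspace.
  move=> m f Sf frf; have [_ spB _] := bB.
  rewrite -(card_ord m); apply: leq_free_span spB _ frf; first exact: B_subspace.
  by move=> i; apply: (Sf i).1.1.
have := basis_mod_trans B_subspace N_subspace _ BN bb (split_basis be).
move=> /(_ (fun a Na => Na.1))/(card_basis_mod B_subspace bB).
rewrite card_option card_sum !card_prod !card_ord => e1.
by exists c, r; rewrite -e1 add1n mulnC.
Qed.

End MatrixUnits.

(** * Leavitt families of matrices *)

Definition yword (w : seq 'I_n) := \prod_(i <- w) y i.
(** The reversal makes [xword w] a left inverse of [yword w]. *)
Definition xword (w : seq 'I_n) := \prod_(i <- rev w) x i.

Lemma yword_cons i w : yword (i :: w) = y i * yword w.
Proof. exact: big_cons. Qed.

Lemma yword_cat u v : yword (u ++ v) = yword u * yword v.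
Proof. exact: big_cat. Qed.

Lemma xword_cat u v : xword (u ++ v) = xword v * xword u.
Proof. by rewrite /xword rev_cat big_cat. Qed.

Lemma xword_cons i w : xword (i :: w) = xword w * x i.
Proof. by rewrite -cat1s xword_cat /xword big_seq1. Qed.

Lemma yword1 i : yword [:: i] = y i. Proof. exact: big_seq1. Qed.
Lemma xword1 i : xword [:: i] = x i. Proof. exact: big_seq1. Qed.
Lemma yword0 : yword [::] = 1. Proof. exact: big_nil. Qed.
Lemma xword0 : xword [::] = 1. Proof. exact: big_nil. Qed.

(** No leaf is a proper prefix of another, so distinct leaves meet at a pair of different
    letters. *)
Lemma caterpillar_orthogonal k u v :
  u \in caterpillar i0 k -> v \in caterpillar i0 k ->
  xword u * yword v = (u == v)%:R.
Proof.
elim: k u v => [|k IH] u v /=.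
  by rewrite !inE => /eqP -> /eqP ->; rewrite eqxx xword0 yword0 mulr1.
rewrite !mem_cat => /orP[] /mapP[a ha ->] /orP[] /mapP[b hb ->].
- by rewrite xword1 yword1 xy eqseq_cons andbT.
- move: ha; rewrite mem_filter => /andP[/negPf ai _].
  by rewrite xword1 yword_cons mulrA xy eqseq_cons ai mul0r.
- move: hb; rewrite mem_filter => /andP[/negPf bi _].
  by rewrite yword1 xword_cons -mulrA xy eqseq_cons eq_sym bi mulr0.
by rewrite xword_cons yword_cons -!mulrA (mulrA (x i0)) xy eqxx mul1r IH.
Qed.

Lemma caterpillar_complete k : \sum_(u <- caterpillar i0 k) yword u * xword u = 1.
Proof.
elim: k => [|k IH] /=; first by rewrite big_seq1 xword0 yword0 mulr1.
rewrite big_cat !big_map /= big_filter big_enum_cond /= -[RHS]yx [RHS](bigD1 i0) //=.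
rewrite addrC; congr (_ + _); last by apply: eq_bigr => i _; rewrite yword1 xword1.
under eq_bigr => u _ do rewrite yword_cons xword_cons mulrA -(mulrA (y i0)).
by rewrite -mulr_suml -mulr_sumr IH mulr1.
Qed.

(** * Matrix units over [L] and subalgebras of matrices *)

Section Matrices.
Variable d : nat.
Local Notation M := 'M[L]_d.+1.

Definition unit_mx a (r s : 'I_d.+1) : M := a *: delta_mx r s.

Lemma unit_mxM a b r s t u :
  unit_mx a r s * unit_mx b t u = if s == t then unit_mx (a * b) r u else 0.
Proof.
have unit_scale c v w i j : unit_mx c v w i j = c *+ ((i == v) && (j == w)).
  by rewrite /unit_mx mxE mxE mulr_natr.
apply/matrixP => i j; rewrite mxE (bigD1 s) //= big1 ?addr0 => [|k /negPf ks].
  rewrite !unit_scale eqxx andbT; case: (s == t) => /=; last by rewrite mulr0n mulr0 mxE.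
  by rewrite unit_scale; case: (i == r); case: (j == u); rewrite ?mulr1n ?mulr0n ?mul0r ?mulr0.
by rewrite unit_scale ks andbF mul0r.
Qed.

Lemma unit_mxD r s : {morph (fun a => unit_mx a r s) : a b / a + b}.
Proof. by move=> a b; apply: scalerDl. Qed.

Lemma unit_mx_sum (I : Type) (e : seq I) (P : pred I) F r s :
  unit_mx (\sum_(i <- e | P i) F i) r s = \sum_(i <- e | P i) unit_mx (F i) r s.
Proof. exact: scaler_suml. Qed.

Lemma unit_mx0 r s : unit_mx 0 r s = 0.
Proof. exact: scale0r. Qed.

Lemma sum_unit_mx : \sum_r unit_mx 1 r r = 1.
Proof.
apply/matrixP => i j; rewrite summxE (bigD1 i) //= big1 ?addr0 => [|k /negPf ki].
  by rewrite !mxE eqxx mul1r eq_sym /=.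
by rewrite !mxE eq_sym ki mulr0.
Qed.

Lemma unit_mxE (A : M) : A = \sum_r \sum_s unit_mx (A r s) r s.
Proof. exact: matrix_sum_delta. Qed.

(** Scalars of [K] act through [c%:A], because matrices over [L] are scaled by [L]. *)
Definition subalgebra (A : M -> Prop) :=
  [/\ forall a b, A a -> A b -> A (a + b), forall a b, A a -> A b -> A (a * b),
      forall (c : K) a, A a -> A (c%:A *: a) & A 1].

Section Generation.
Variable A : M -> Prop.
Hypothesis A_subalgebra : subalgebra A.

Lemma subalgebra0 : A 0.
Proof. by case: A_subalgebra => _ _ /(_ 0) AZ /AZ; rewrite !scale0r. Qed.

Lemma subalgebraD a b : A a -> A b -> A (a + b).
Proof. by case: A_subalgebra => AD _ _ _; apply: AD. Qed.

Lemma subalgebraM a b : A a -> A b -> A (a * b).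
Proof. by case: A_subalgebra => _ AM _ _; apply: AM. Qed.

Lemma subalgebra_sum (I : Type) (e : seq I) (P : pred I) F :
  (forall i, P i -> A (F i)) -> A (\sum_(i <- e | P i) F i).
Proof. by apply: big_ind; [exact: subalgebra0 | exact: subalgebraD]. Qed.

Lemma subalgebraB a b : A a -> A b -> A (a - b).
Proof.
case: A_subalgebra => AD _ AZ _ Aa Ab; apply: AD => //.
by have := AZ (-1) _ Ab; rewrite !scaleN1r.
Qed.

Lemma subalgebra_trans a b r s t :
  A (unit_mx a r s) -> A (unit_mx b s t) -> A (unit_mx (a * b) r t).
Proof. by move=> Aa /(subalgebraM Aa); rewrite unit_mxM eqxx. Qed.

(** An entry [a] at [(r, s)] factors through the corner at [ord0], where [gen] produces every [a]
    from its letters. *)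
Lemma subalgebra_full :
    (forall i, A (unit_mx (x i) ord0 ord0)) ->
    (forall i, A (unit_mx (y i) ord0 ord0)) ->
    (forall r, A (unit_mx 1 r ord0)) -> (forall r, A (unit_mx 1 ord0 r)) ->
  forall B, A B.
Proof.
move=> Ax Ay Ar Al B; rewrite (unit_mxE B).
apply: subalgebra_sum => r _; apply: subalgebra_sum => s _.
rewrite -[B r s]mul1r -[1 * _]mulr1.
apply: subalgebra_trans (Al s); apply: subalgebra_trans (Ar r) _.
move: (B r s); apply: gen => [||a i Aa|a j Aa].
- split=> [|c a b Aa Ab]; first by rewrite unit_mx0; apply: subalgebra0.
  rewrite unit_mxD; apply: subalgebraD => //.
  case: A_subalgebra => _ _ /(_ c _ Aa) + _.
  by rewrite /unit_mx scalerA mulr_algl.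
- exact: Ar.
- exact: subalgebra_trans (Ax i).
exact: subalgebra_trans (Ay j).
Qed.

End Generation.
End Matrices.

(** * The Leavitt family of matrices attached to a forest *)

Section Construction.
Variables (d : nat) (leaves : seq (seq 'I_n)).
Hypothesis leaves_perm : perm_eq leaves (caterpillar i0 d.+1).
Local Notation M := 'M[L]_d.+2.

Let size_leaves : size leaves = (d.+1 * n.-1 + 1)%N.
Proof. by rewrite (perm_size leaves_perm) size_caterpillar. Qed.

(* The [n (d + 2)] leaves of a forest with [d + 2] roots are numbered so that
   the numbers [t = i (d + 2) + j] with [j < d + 2] index the columns of the
   image of [y_i].  Root [0] has [n] leaves, the roots [1, ..., d] are leaves,
   and below root [d + 1] hangs a caterpillar. *)
Definition leaf_root t : 'I_d.+2 := inord (minn d.+1 (t.+1 - n)).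
Definition leaf_word t :=
  if (t < n)%N then [:: insubd i0 t] else nth [::] (nseq d [::] ++ leaves) (t - n).

Variant leaf_spec t : nat -> seq 'I_n -> Type :=
| LeafFirst of (t < n)%N : leaf_spec t 0 [:: insubd i0 t]
| LeafRoot of (n <= t < n + d)%N : leaf_spec t (t.+1 - n) [::]
| LeafLast of (n + d <= t)%N & (t - n - d < size leaves)%N :
    leaf_spec t d.+1 (nth [::] leaves (t - n - d)).

Lemma leafP t : (t < n * d.+2)%N -> leaf_spec t (leaf_root t) (leaf_word t).
Proof.
move=> tlt; rewrite /leaf_root /leaf_word inordK; last by rewrite ltnS geq_minl.
case: ltnP => tn.
  by rewrite (_ : (t.+1 - n = 0)%N) ?minn0; [constructor | lia].
rewrite nth_cat size_nseq nth_nseq if_same; case: ltnP => td.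
  by rewrite (minn_idPr _); [constructor; lia | lia].
rewrite (minn_idPl _); last lia.
by constructor; [lia | rewrite size_leaves; nia].
Qed.

Lemma leaf_orthogonal s t : (s < n * d.+2)%N -> (t < n * d.+2)%N ->
  leaf_root s = leaf_root t -> xword (leaf_word s) * yword (leaf_word t) = (s == t)%:R.
Proof.
move=> sD tD /(congr1 (@nat_of_ord _)).
case: (leafP sD) => [sn|sn|sn sl]; case: (leafP tD) => [tn|tn|tn tl] rst;
  try by exfalso; lia.
- by rewrite xword1 yword1 xy -val_eqE !val_insubd sn tn.
- by rewrite xword0 yword0 mulr1 (_ : s == t = true) //; apply/eqP; lia.
- rewrite (@caterpillar_orthogonal d.+1) -?(perm_mem leaves_perm) ?mem_nth //.
  rewrite nth_uniq // ?(perm_uniq leaves_perm) ?caterpillar_uniq //.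
  by congr (_%:R); apply: congr1; lia.
Qed.

Definition label (i : 'I_n) (j : 'I_d.+2) : nat := i * d.+2 + j.

Lemma label_lt i j : (label i j < n * d.+2)%N.
Proof. by rewrite /label; have := ltn_ord i; have := ltn_ord j; nia. Qed.

Lemma label_eq i j i' j' : (label i j == label i' j') = (i == i') && (j == j').
Proof.
apply/eqP/andP => [e|[/eqP -> /eqP ->] //].
have dj : ((label i j) %/ d.+2 = i)%N by rewrite divnMDl // divn_small ?addn0.
have dj' : ((label i' j') %/ d.+2 = i')%N by rewrite divnMDl // divn_small ?addn0.
have ii : i = i' by apply: ord_inj; rewrite -dj -dj' e.
split; first by rewrite ii.
apply/eqP; apply: ord_inj; apply: (@addnI (i * d.+2)%N).
by rewrite -/(label i j) e /label ii.
Qed.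

Lemma label_divn t : (t < n * d.+2)%N -> exists i j, label i j = t.
Proof.
move=> tn; have ti : (t %/ d.+2 < n)%N by rewrite ltn_divLR.
exists (Ordinal ti), (Ordinal (ltn_pmod t (ltn0Sn d.+1))).
by rewrite /label /= -divn_eq.
Qed.

Lemma sum_label (F : nat -> M) :
  \sum_i \sum_j F (label i j) = \sum_(0 <= t < n * d.+2) F t.
Proof.
rewrite big_nat_mul big_mkord; apply: eq_bigr => i _.
rewrite -[X in \sum_(X <= t < _) _]add0n big_addn mulSn addnK big_mkord.
by apply: eq_bigr => j _; rewrite addnC.
Qed.

(** The numbers split into the children of root [0], the trivial trees, and the caterpillar. Each
    tree contributes the diagonal unit at its root. *)
Lemma leaf_complete :
  \sum_(0 <= t < n * d.+2)
    unit_mx (yword (leaf_word t) * xword (leaf_word t)) (leaf_root t) (leaf_root t)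
  = 1.
Proof.
rewrite (@big_cat_nat _ _ _ n) //=; last by nia.
rewrite (@big_cat_nat _ _ _ (n + d) n) /=; [|lia|nia].
rewrite -sum_unit_mx big_ord_recl big_ord_recr /=; congr (_ + (_ + _)).
- rewrite -yx unit_mx_sum big_mkord; apply: eq_bigr => i _.
  rewrite /leaf_word ltn_ord yword1 xword1 /insubd valK /=.
  congr (unit_mx _ _ _); apply: ord_inj;
    by rewrite inordK ?ltnS ?geq_minl //=; have := ltn_ord i; lia.
- rewrite -{1}[n]add0n big_addn addKn big_mkord; apply: eq_bigr => i _.
  have tn : (n <= i + n < n + d)%N by have := ltn_ord i; lia.
  have -> : leaf_root (i + n) = lift ord0 (widen_ord (leqnSn d) i).
    apply: ord_inj; rewrite inordK ?ltnS ?geq_minl //=.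
    by rewrite /bump /=; have := ltn_ord i; lia.
  have -> : leaf_word (i + n) = [::].
    rewrite /leaf_word ltnNge leq_addl /= addnK nth_cat size_nseq ltn_ord.
    by rewrite nth_nseq if_same.
  by rewrite yword0 xword0 mulr1.
rewrite -{1}[(n + d)%N]add0n big_addn.
have -> : (n * d.+2 - (n + d) = size leaves)%N by rewrite size_leaves; nia.
transitivity (\sum_(u <- leaves) unit_mx (yword u * xword u) ord_max ord_max : M).
  rewrite (big_nth [::]); apply: eq_big_nat => t /andP[_ ts].
  have -> : leaf_root (t + (n + d)) = ord_max.
    by apply: ord_inj; rewrite inordK ?ltnS ?geq_minl //=; lia.
  have -> // : leaf_word (t + (n + d)) = nth [::] leaves t.
  rewrite /leaf_word ifF; last lia.
  by rewrite nth_cat size_nseq ifF; [congr nth|]; lia.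
rewrite (perm_big _ leaves_perm) -unit_mx_sum caterpillar_complete /=.
by congr (unit_mx _ _ _); apply: ord_inj.
Qed.

Definition mx_x i : M :=
  \sum_j unit_mx (xword (leaf_word (label i j))) j (leaf_root (label i j)).
Definition mx_y i : M :=
  \sum_j unit_mx (yword (leaf_word (label i j))) (leaf_root (label i j)) j.

Lemma mx_xy i i' : mx_x i * mx_y i' = (i == i')%:R.
Proof.
have -> : mx_x i * mx_y i' =
    \sum_j \sum_j' unit_mx ((label i j == label i' j')%:R) j j'.
  rewrite mulr_suml; apply: eq_bigr => j _; rewrite mulr_sumr.
  apply: eq_bigr => j' _; rewrite unit_mxM; case: eqP => [e|ne].
    by rewrite leaf_orthogonal ?label_lt.
  by case: eqP => [le|_]; [rewrite le in ne | rewrite unit_mx0].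
case: (eqVneq i i') => [->|ii]; last first.
  rewrite big1 // => j _; rewrite big1 // => j' _.
  by rewrite label_eq (negPf ii) unit_mx0.
rewrite -sum_unit_mx; apply: eq_bigr => j _.
rewrite (bigD1 j) //= label_eq !eqxx big1 ?addr0 // => j' /negPf jj.
by rewrite label_eq eq_sym eqxx jj unit_mx0.
Qed.

Lemma mx_yx : \sum_i mx_y i * mx_x i = 1.
Proof.
rewrite -leaf_complete -sum_label; apply: eq_bigr => i _.
rewrite mulr_suml; apply: eq_bigr => j _; rewrite mulr_sumr (bigD1 j) //=.
rewrite unit_mxM eqxx big1 ?addr0 // => j' /negPf jj.
by rewrite unit_mxM eq_sym jj.
Qed.

(** * The family generates all matrices *)

Section Surjectivity.
Variables m k : nat.
Hypothesis m_bounds : (0 < m < d.+2)%N.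
Hypothesis m_inverse : (n.-1 * m = 1 + d.+2 * k)%N.
Hypothesis leaves_coloured :
  [seq balanced d.+2 m (last i0 u) | u <- leaves] =
  [seq balanced d.+2 m t | t <- iota (n + d) (d.+1 * n.-1 + 1)].
Variable A : M -> Prop.
Hypothesis A_subalgebra : subalgebra A.
Hypothesis A_x : forall i, A (mx_x i).
Hypothesis A_y : forall i, A (mx_y i).

Let trans {a b r s t} := @subalgebra_trans d.+1 A A_subalgebra a b r s t.

Definition initial_mx g : M := \sum_(j < d.+2 | (j < g)%N) unit_mx 1 j j.

Lemma initial_mxl g a r s :
  initial_mx g * unit_mx a r s = if (r < g)%N then unit_mx a r s else 0.
Proof.
rewrite mulr_suml big_mkcond (bigD1 r) //= big1 ?addr0 => [|j /negPf jr].
  by case: ifP => // _; rewrite unit_mxM eqxx mul1r.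
by rewrite unit_mxM jr; case: ifP.
Qed.

Lemma initial_mxr g a r s :
  unit_mx a r s * initial_mx g = if (s < g)%N then unit_mx a r s else 0.
Proof.
rewrite mulr_sumr big_mkcond (bigD1 s) //= big1 ?addr0 => [|j /negPf js].
  by case: ifP => // _; rewrite unit_mxM eqxx mulr1.
by rewrite unit_mxM eq_sym js; case: ifP.
Qed.

(** Since [leaf_root] is monotone, the leaves on the first [g] roots are those numbered below
    [g + n - 1]. Column [j] of [mx_y i] carries the leaf [i * d.+2 + j]. *)
Lemma initial_mx_y g i : (0 < g <= d.+1)%N ->
  initial_mx g * mx_y i = mx_y i * initial_mx (g + n.-1 - i * d.+2).
Proof.
move=> gd; rewrite mulr_sumr mulr_suml; apply: eq_bigr => j _.
rewrite initial_mxl initial_mxr; congr (if _ then _ else _).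
rewrite inordK ?ltnS ?geq_minl // /label gtn_min; lia.
Qed.

Lemma initial_mx0 : initial_mx 0 = 0.
Proof. exact: big_pred0_eq. Qed.

Lemma initial_mx_full g : (d.+2 <= g)%N -> initial_mx g = 1.
Proof.
move=> dg; rewrite -sum_unit_mx; apply: eq_bigl => j.
by rewrite (leq_trans (ltn_ord j) dg).
Qed.

(** Inserting [mx_yx] turns [initial_mx g] into a sum over [i] of [mx_y i * initial_mx h * mx_x i].
    Each middle factor is [0], [1], or the one whose [h] is the residue of [g + n - 1]. *)
Lemma initial_mx_step g : (0 < g <= d.+1)%N ->
  A (initial_mx ((g + n.-1) %% d.+2)) -> A (initial_mx g).
Proof.
move=> gd Ag; rewrite -[initial_mx g]mulr1 -mx_yx mulr_sumr.
apply: (subalgebra_sum A_subalgebra) => i _.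
rewrite mulrA initial_mx_y //.
apply: (subalgebraM A_subalgebra) => //; apply: (subalgebraM A_subalgebra) => //.
set h := (g + n.-1 - i * d.+2)%N; have [->|h0] := posnP h.
  by rewrite initial_mx0; apply: subalgebra0.
have [hd|hd] := leqP d.+2 h; first by rewrite initial_mx_full //; case: A_subalgebra.
suff <- : ((g + n.-1) %% d.+2 = h)%N by [].
have -> : (g + n.-1 = i * d.+2 + h)%N by rewrite /h; lia.
by rewrite modnMDl modn_small.
Qed.

Lemma initial_mx_sub g : (g <= d.+1)%N -> A (initial_mx g).
Proof.
move=> gd.
have H e : forall g, (g <= d.+1)%N -> ((g + e * n.-1) %% d.+2 = 0)%N -> A (initial_mx g).
  elim: e => [|e IH] [|h] hd; rewrite ?initial_mx0.
  - by move=> _; apply: subalgebra0.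
  - by rewrite mul0n addn0 modn_small.
  - by move=> _; apply: subalgebra0.
  move=> he; apply: initial_mx_step => //; apply: IH.
    by rewrite -ltnS ltn_pmod.
  by rewrite modnDml -addnA -mulSn.
(* As [m] inverts [n - 1] modulo [d.+2], this many steps carry [g] to [0]. *)
apply: (H (m * (d.+2 - g))%N) => //.
have -> : (g + m * (d.+2 - g) * n.-1 = (1 + k * (d.+2 - g)) * d.+2)%N.
  rewrite mulnAC [(m * _)%N]mulnC m_inverse.
  have : (g <= d.+2)%N by lia.
  move=> /subnKC; set e := (d.+2 - g)%N; nia.
by rewrite modnMl.
Qed.

Lemma unit_mx_diag r : A (unit_mx 1 r r).
Proof.
have -> : unit_mx 1 r r = initial_mx r.+1 - initial_mx r.
  apply: (canRL (addrK _)); rewrite [RHS](bigD1 r) //=; congr (_ + _).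
  by apply: eq_bigl => j; rewrite ltnS ltn_neqAle andbC -val_eqE.
apply: (subalgebraB A_subalgebra); last by apply: initial_mx_sub; rewrite -ltnS.
have [rd|rd] := leqP r.+1 d.+1; first exact: initial_mx_sub.
by rewrite initial_mx_full //; case: A_subalgebra.
Qed.

Lemma leaf_sub i j (t := label i j) :
  A (unit_mx (yword (leaf_word t)) (leaf_root t) j) /\
  A (unit_mx (xword (leaf_word t)) j (leaf_root t)).
Proof.
split.
  have := subalgebraM A_subalgebra (A_y i) (unit_mx_diag j).
  rewrite mulr_suml (bigD1 j) //= big1 ?addr0 => [|j' /negPf jj].
    by rewrite unit_mxM eqxx mulr1.
  by rewrite unit_mxM jj.
have := subalgebraM A_subalgebra (unit_mx_diag j) (A_x i).
rewrite mulr_sumr (bigD1 j) //= big1 ?addr0 => [|j' /negPf jj].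
  by rewrite unit_mxM eqxx mul1r.
by rewrite unit_mxM eq_sym jj.
Qed.

Let chi := balanced d.+2 m.
(** The representative root of each colour: root [0] is coloured and the last root is not. *)
Let rho t : 'I_d.+2 := if chi t then ord0 else ord_max.

Lemma rho0 : rho 0 = ord0.
Proof.
have [m0 mD] := andP m_bounds; rewrite /rho ifT // /chi /balanced mul1n.
by rewrite modn_small; lia.
Qed.

(* Roots of equal colour are equivalent: leaf [r + n - 1] is root [r] for
   [0 < r <= d], so [r] is equivalent to [r + n - 1] modulo [d + 2]. *)
Lemma root_colour (r : 'I_d.+2) : A (unit_mx 1 r (rho r)) /\ A (unit_mx 1 (rho r) r).
Proof.
have [m0 mD] := andP m_bounds.
have co : coprime d.+2 m.
  have gD : (gcdn d.+2 m %| d.+2 * k)%N by rewrite dvdn_mulr ?dvdn_gcdl.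
  by rewrite /coprime -dvdn1 -(dvdn_addl _ gD) -m_inverse dvdn_mull ?dvdn_gcdr.
(* The rotation by [n - 1] raises [pos] by one, and the coloured roots are those with [pos < m].
   Roots [0] and [d + 1] have positions [m - 1] and [d + 1], the tops of the two classes, so every
   chain climbs to its representative. *)
pose pos t := ((t.+1 * m).-1 %% d.+2)%N.
have [e] := ubnP (d.+1 - pos r)%N; elim: e r => // e IH r re.
have [r0|r0] := posnP r.
  have -> : r = ord0 by apply: ord_inj.
  by rewrite rho0; split; apply: unit_mx_diag.
have [rd|rd] := leqP d.+1 r.
  have -> : r = ord_max by apply: ord_inj; apply/eqP; rewrite eqn_leq rd -ltnS ltn_ord.
  rewrite /rho /chi /balanced /=.
  have -> : ((d.+2 * m).-1 = m.-1 * d.+2 + d.+1)%N by nia.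
  rewrite modnMDl modn_small // ltnNge -ltnS mD.
  by split; apply: unit_mx_diag.
have [i [j tij]] : exists i j, label i j = (r + n.-1)%N by apply: label_divn; nia.
have rj : (j = (r + n.-1) %% d.+2 :> nat)%N.
  by rewrite -tij modnMDl modn_small.
have posj : pos j = (pos r).+1.
  have -> : pos j = ((r.+1 * m).-1.+1 %% d.+2)%N.
    rewrite /pos rj; have := divn_eq (r + n.-1) d.+2.
    set q := (_ %/ _)%N; set s := (_ %% _)%N => e1.
    rewrite -(modnMDl (q * m) (s.+1 * m).-1).
    have -> : (q * m * d.+2 + (s.+1 * m).-1 = k * d.+2 + (r.+1 * m).-1.+1)%N.
      have := congr1 (muln^~ m) e1; rewrite !mulnDl m_inverse => e2.
      by rewrite !mulSn; lia.
    by rewrite modnMDl.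
  have := ltn_mod (r.+1 * m).-1 d.+2; rewrite -/(pos r) /= => pr.
  rewrite -addn1 -modnDml -/(pos r) addn1 modn_small //.
  (* No wrap-around: position [d + 1] would make [d.+2] divide [r + 1], but [0 < r < d + 1]. *)
  rewrite ltn_neqAle pr andbT; apply/eqP => pe.
  have : (d.+2 %| r.+1 * m)%N.
    have X0 : (0 < r.+1 * m)%N by rewrite muln_gt0 m0.
    have := divn_eq (r.+1 * m).-1 d.+2; rewrite -/(pos r).
    move: (_ %/ _)%N => q e1; apply/dvdnP; exists q.+1; rewrite [RHS]mulSn; lia.
  by rewrite Gauss_dvdl // => /dvdn_leq; lia.
have chij : chi j = chi r.
  rewrite /chi /balanced -/(pos j) -/(pos r) posj.
  have [pm|pm] := ltnP (pos r) m; last by rewrite ltnNge leqW.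
  (* No change of class: position [m - 1] would make [d.+2] divide [r]. *)
  rewrite ltn_neqAle pm andbT; apply/eqP => pe.
  have : (d.+2 %| r * m)%N.
    have := divn_eq (r.+1 * m).-1 d.+2; rewrite -/(pos r) mulSn.
    move: (_ %/ _)%N => q e1; apply/dvdnP; exists q; lia.
  by rewrite Gauss_dvdl // => /dvdn_leq; lia.
have [|Ajl Ajr] := IH j; first by move: re posj (ltn_mod (j.+1 * m).-1 d.+2);
  rewrite -/(pos j) => + -> ; move: (pos r) => p; lia.
have [] := leaf_sub i j; rewrite tij.
have -> : leaf_root (r + n.-1) = r.
  by apply: ord_inj; rewrite inordK ?ltnS ?geq_minl //=; lia.
have -> : leaf_word (r + n.-1) = [::].
  rewrite /leaf_word ifF; last lia.
  rewrite nth_cat size_nseq nth_nseq if_same ifT //; lia.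
rewrite yword0 xword0 => Al Ar.
have <- : rho j = rho r by rewrite /rho chij.
by split; [have := trans Al Ajl | have := trans Ajr Ar]; rewrite mulr1.
Qed.

(** Leaf [t] is linked to the root [t] modulo [d.+2] by [leaf_sub], and the colour of [t] depends
    only on that residue. *)
Lemma leaf_colour t : (t < n * d.+2)%N ->
  A (unit_mx (yword (leaf_word t)) (leaf_root t) (rho t)) /\
  A (unit_mx (xword (leaf_word t)) (rho t) (leaf_root t)).
Proof.
move=> /label_divn[i [j tij]].
have -> : rho t = rho j.
  rewrite /rho /chi -(balanced_mod d.+2 t) ?(andP m_bounds).1 //.
  by rewrite -tij modnMDl modn_small.
have [Ayw Axw] := leaf_sub i j; rewrite tij in Ayw Axw.
have [Al Ar] := root_colour j.
by split; [have := trans Ayw Al; rewrite mulr1 | have := trans Ar Axw; rewrite mul1r].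
Qed.

Lemma letter_colour i :
  A (unit_mx (y i) ord0 (rho i)) /\ A (unit_mx (x i) (rho i) ord0).
Proof.
have [|] := @leaf_colour i; first by have := ltn_ord i; nia.
have -> : leaf_word i = [:: i] by rewrite /leaf_word ltn_ord /insubd valK.
have -> : leaf_root i = ord0.
  by apply: ord_inj; rewrite inordK ?ltnS ?geq_minl //=; have := ltn_ord i; lia.
by rewrite yword1 xword1.
Qed.

(* A node whose caterpillar leaves are coloured like the corresponding children
   of root [0] is equivalent to root [0], by induction from the bottom. *)
Lemma caterpillar_colour e r u :
    (forall v, v \in caterpillar i0 e ->
      A (unit_mx (yword (u ++ v)) r (rho (last i0 v))) /\
      A (unit_mx (xword (u ++ v)) (rho (last i0 v)) r)) ->
  A (unit_mx (yword u) r ord0) /\ A (unit_mx (xword u) ord0 r).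
Proof.
elim: e u => [|e IH] u H.
  by have := H [::] (mem_head _ _); rewrite cats0 /= rho0.
have child i : A (unit_mx (yword (u ++ [:: i])) r (rho i)) /\
    A (unit_mx (xword (u ++ [:: i])) (rho i) r).
  (* A child other than [i0] is a leaf; the child [i0] is the top of a shorter caterpillar. *)
  have [->|ii] := eqVneq i i0; last first.
    apply: (H [:: i]); rewrite /= mem_cat map_f // mem_filter ii.
    by rewrite mem_enum.
  rewrite rho0; apply: IH => v hv; rewrite -catA.
  by apply: (H (i0 :: v)); rewrite /= mem_cat (map_f (cons i0) hv) orbT.
split.
  rewrite -[yword u]mulr1 -yx mulr_sumr unit_mx_sum.
  apply: (subalgebra_sum A_subalgebra) => i _.
  have := trans (child i).1 (letter_colour i).2.
  by rewrite yword_cat yword1 mulrA.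
rewrite -[xword u]mul1r -yx mulr_suml unit_mx_sum.
apply: (subalgebra_sum A_subalgebra) => i _.
have := trans (letter_colour i).1 (child i).2.
by rewrite xword_cat xword1 mulrA.
Qed.

(** Here the two classes merge: by [leaves_coloured], the colour of a caterpillar leaf's number is
    that of its last letter, so [caterpillar_colour] applies at the last root. *)
Lemma last_root_colour : A (unit_mx 1 ord_max ord0) /\ A (unit_mx 1 ord0 ord_max).
Proof.
have := @caterpillar_colour d.+1 ord_max [::]; rewrite yword0 xword0; apply=> v.
rewrite -(perm_mem leaves_perm) cat0s => hv.
pose s := index v leaves; pose t := (n + d + s)%N.
have sl : (s < size leaves)%N by rewrite index_mem.
have tn : (t < n * d.+2)%N by move: sl; rewrite size_leaves /t; nia.
have -> : rho (last i0 v) = rho t.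
  rewrite /rho; congr (if _ then _ else _).
  have := congr1 (fun l => nth false l s) leaves_coloured.
  rewrite (nth_map [::]) // (nth_map 0) ?size_iota -?size_leaves //.
  by rewrite nth_iota -?size_leaves // nth_index.
have -> : v = leaf_word t.
  rewrite /leaf_word ifF; last by rewrite /t; lia.
  rewrite nth_cat size_nseq ifF; last by rewrite /t; lia.
  by rewrite (_ : (t - n - d = s)%N) ?nth_index // /t; lia.
have -> : ord_max = leaf_root t.
  by apply: ord_inj; rewrite inordK ?ltnS ?geq_minl //= /t; lia.
exact: leaf_colour.
Qed.

Lemma mx_generated B : A B.
Proof.
have [Am0 A0m] := last_root_colour.
have Arho t : A (unit_mx 1 (rho t) ord0) /\ A (unit_mx 1 ord0 (rho t)).
  by rewrite /rho; case: ifP => // _; split; apply: unit_mx_diag.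
apply: (subalgebra_full A_subalgebra) => [i|i|r|r].
- by have := trans (Arho i).2 (letter_colour i).2; rewrite mul1r.
- by have := trans (letter_colour i).1 (Arho i).1; rewrite mulr1.
- by have := trans (root_colour r).1 (Arho r).1; rewrite mulr1.
by have := trans (Arho r).2 (root_colour r).2; rewrite mulr1.
Qed.

End Surjectivity.
End Construction.
End LeavittFamily.

(** * The presented Leavitt algebra *)

Section LeavittUniversal.
Variables (K : fieldType) (n : nat) (n_ge2 : (1 < n)%N).
Local Notation L := (leavitt K n_ge2).

Lemma leavitt_pi_surj (a : L) : exists p, @leavitt_pi K n n_ge2 p = a.
Proof.
by exists (repr (a : {quot (@leavitt_ideal K n)})); apply: reprK.
Qed.

Lemma leavitt_gen (P : L -> Prop) : subspace P -> P 1 ->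
    (forall a i, P a -> P (a * leavitt_x K n_ge2 i)) ->
    (forall a j, P a -> P (a * leavitt_y K n_ge2 j)) ->
  forall a, P a.
Proof.
move=> sP P1 Px Py a; have [p <-] := leavitt_pi_surj a.
rewrite (monalgE p) rmorph_sum /=; apply: subspace_sum => // w _.
have -> : << p@_w *g w >> = p@_w *: << w >> :> leavitt_free K n.
  by apply/malgP => v; rewrite mcoeffZ !mcoeffU mulrnAr mulr1.
rewrite linearZ; apply: subspaceZ => //; rewrite -(fmK w).
elim/last_ind: (w : seq _) => [|s g IH].
  by rewrite -fmoneE (rmorph1 (@leavitt_pi K n n_ge2)).
have -> : << FMonom (rcons s g) >> = << FMonom s >> * << fmu g >> :> leavitt_free K n.
  by rewrite malgM_def fgmulUU mulr1 fmuE /mmul /= fmmulE cats1.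
by rewrite rmorphM; case: g => [i|j]; [apply: Px | apply: Py].
Qed.

(** Evaluation of words on the free algebra is multiplicative because [iota] is central, and it
    descends to the quotient because it kills the relations. *)
Lemma leavitt_universal (S : nzRingType) (iota : {rmorphism K -> S})
    (X Y : 'I_n -> S) :
    (forall c s, GRing.comm (iota c) s) ->
    (forall i j, X i * Y j = (i == j)%:R) -> \sum_j Y j * X j = 1 ->
  exists f : L -> S, [/\ zmod_morphism f, monoid_morphism f,
    forall c a, f (c *: a) = iota c * f a,
    forall i, f (leavitt_x K n_ge2 i) = X i &
    forall j, f (leavitt_y K n_ge2 j) = Y j].
Proof.
move=> central XY YX.
pose letter g := match g with inl i => X i | inr j => Y j end.
pose h0 (w : {fmonom ('I_n + 'I_n)%type}) := \prod_(g <- (w : seq _)) letter g.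
have h0M : mmorphism h0.
  by split=> [u v|]; rewrite /h0 ?fmM ?big_cat // fm1 big_nil.
pose h : {mmorphism {fmonom ('I_n + 'I_n)%type} -> S} :=
  HB.pack h0 (monalg.isMultiplicative.Build _ _ h0 h0M).
pose phi := mmap iota h.
have [phi1 phiM] : GRing.monoid_morphism phi.
  by have [] := commr_mmap_is_multiplicative (fun g m m' => central g@_m (h m')).
have phiB : {morph phi : p q / p - q} by apply: mmapB.
have phiD : {morph phi : p q / p + q} by apply: mmapD.
have phi0 : phi 0 = 0 by apply: mmap0.
have phiU g : phi << fmu g >> = letter g.
  by rewrite /phi mmapU /= rmorph1 mul1r /= /h0 fmU big_seq1.
have phi_rel p : ideal_span (@leavitt_rel K n) p -> phi p = 0.
  elim=> {p} [p []|//|p q _ p0 _ q0|a p _ p0|a p _ p0].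
  - move=> i j; rewrite phiB phiM !phiU /= XY -{1}[(i == j)%:R]mulr1.
    by rewrite mulr_natl /phi raddfMn /= -/(phi 1) phi1 subrr.
  - rewrite phiB phi1 /phi raddf_sum /= -[X in _ - X]YX -sumrB big1 // => j _.
    by rewrite -/(phi _) phiM !phiU subrr.
  - by rewrite phiD p0 q0 addr0.
  - by rewrite phiM p0 mulr0.
  by rewrite phiM p0 mul0r.
have reprP p : phi (repr (leavitt_pi n_ge2 p : {quot (@leavitt_ideal K n)})) = phi p.
  apply/eqP; rewrite -subr_eq0 -phiB; apply/eqP/phi_rel/leavitt_idealP.
  by apply/leavitt_pi_eq; apply: reprK.
exists (fun a : L => phi (repr (a : {quot (@leavitt_ideal K n)}))); split.
- move=> a b; have [p <-] := leavitt_pi_surj a; have [q <-] := leavitt_pi_surj b.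
  by rewrite -raddfB !reprP phiB.
- split=> [|a b]; first by rewrite -(rmorph1 (leavitt_pi n_ge2)) reprP.
  have [p <-] := leavitt_pi_surj a; have [q <-] := leavitt_pi_surj b.
  by rewrite -rmorphM !reprP phiM.
- move=> c a; have [p <-] := leavitt_pi_surj a.
  by rewrite -linearZ !reprP /phi mmapZ.
- by move=> i; rewrite reprP phiU.
by move=> j; rewrite reprP phiU.
Qed.

End LeavittUniversal.

(** * Isomorphisms between [L] and its matrix algebras *)

Section MatrixIsomorphism.
Variables (K : fieldType) (n : nat) (n_ge2 : (1 < n)%N) (d : nat).
Local Notation L := (leavitt K n_ge2).
Local Notation M := 'M[L]_d.+1.

Let leavitt_simple (a : L) : a != 0 -> exists p r, p * a * r = 1.
Proof.
exact: (leavitt_family_simple n_ge2 (@leavitt_xy K n n_ge2)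
  (@leavitt_yx K n n_ge2) (@leavitt_gen K n n_ge2)).
Qed.

Lemma leavitt_iso_mx (X Y : 'I_n -> M) :
    (forall i j, X i * Y j = (i == j)%:R) -> \sum_j Y j * X j = 1 ->
    (forall A : M -> Prop, subalgebra A ->
      (forall i, A (X i)) -> (forall i, A (Y i)) -> forall B, A B) ->
  exists f : {lrmorphism L -> M | GRing.in_alg L \; *:%R}, bijective f.
Proof.
move=> XY YX XYgen.
pose iota : {rmorphism K -> M} := (@scalar_mx L d.+1) \o (GRing.in_alg L).
have iotaE c (B : M) : iota c * B = c%:A *: B by apply: mul_scalar_mx.
have central c B : GRing.comm (iota c) B.
  apply/matrixP => i j; rewrite iotaE !mxE (bigD1 j) //=.
  rewrite big1 ?addr0 => [|k /negPf kj]; last by rewrite mxE kj mulr0.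
  by rewrite mxE eqxx mulr_algl mulr_algr.
have [f0 [fB fM fZ fX fY]] := leavitt_universal n_ge2 central XY YX.
have fS : scalable_for (GRing.in_alg L \; *:%R) f0.
  by move=> c a; rewrite fZ iotaE.
pose f : {lrmorphism L -> M | GRing.in_alg L \; *:%R} :=
  HB.pack f0 (GRing.isZmodMorphism.Build _ _ f0 fB)
    (GRing.isMonoidMorphism.Build _ _ f0 fM)
    (GRing.isScalable.Build _ _ _ _ f0 fS).
have f_surj B : exists a, f a = B.
  apply: (XYgen (fun B => exists a, f a = B)) => [|i|i]; last 2 first.
  - by exists (leavitt_x K n_ge2 i); apply: fX.
  - by exists (leavitt_y K n_ge2 i); apply: fY.
  split=> [_ _ [a <-] [b <-]|_ _ [a <-] [b <-]|c _ [a <-]|].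
  - by exists (a + b); rewrite raddfD.
  - by exists (a * b); rewrite rmorphM.
  - by exists (c *: a); apply: fS.
  by exists 1; rewrite rmorph1.
have f_inj : injective f.
  (* A nonzero [a] in the kernel would have [p * a * r = 1], whose image is zero. *)
  apply: raddf_inj => a fa; apply/eqP; apply: contraT => /leavitt_simple[p [r par]].
  have := fM.1; rewrite -par !fM.2 (fa : f0 a = 0) mulr0 mul0r.
  by move=> /eqP; rewrite eq_sym oner_eq0.
have [g gK] := choice f_surj.
by exists f, g => // a; apply: f_inj.
Qed.

Lemma leavitt_iso_mx_coprime (f : {lrmorphism L -> M | GRing.in_alg L \; *:%R}) :
  bijective f -> coprime d.+1 n.-1.
Proof.
case=> g fK gK.
pose E i j := g (delta_mx i j).
have EE i j k l : E i j * E k l = E i l *+ (j == k).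
  apply: (can_inj fK); rewrite rmorphM raddfMn /= !gK.
  exact: mul_delta_mx_cond.
have sumE : \sum_i E i i = 1.
  apply: (can_inj fK); rewrite raddf_sum rmorph1 -sum_unit_mx.
  by apply: eq_bigr => i _; rewrite /= gK /unit_mx scale1r.
have [c [r cr]] := matrix_units_card n_ge2 (@leavitt_xy K n n_ge2)
  (@leavitt_gen K n n_ge2) EE sumE.
have e : (d.+1 * r = 1 + n.-1 * c)%N by have := n_ge2; nia.
rewrite /coprime -dvdn1 -(@dvdn_addl (n.-1 * c)) -?e.
  by rewrite dvdn_mulr ?dvdn_gcdl.
by rewrite dvdn_mulr ?dvdn_gcdr.
Qed.

End MatrixIsomorphism.

Theorem theorem4p14 (d n : nat) (d_ge1 : (1 <= d)%N) (n_ge2 : (2 <= n)%N)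
    (K : fieldType) :
  (exists f : {lrmorphism leavitt K n_ge2 -> 'M[leavitt K n_ge2]_d
                | GRing.in_alg (leavitt K n_ge2) \; *:%R},
     bijective f)
  <-> gcdn d (n - 1) = 1%N.
Proof.
have xy := @leavitt_xy K n n_ge2; have yx := @leavitt_yx K n n_ge2.
have gen := @leavitt_gen K n n_ge2.
rewrite subn1; case: d d_ge1 => // d _; split=> [[f /leavitt_iso_mx_coprime/eqP]|] //.
(* The forest needs two distinct roots, [0] and the last one; size one is settled by the generators
   themselves as 1 x 1 matrices. *)
case: d => [_|d dn].
  pose X i := unit_mx (leavitt_x K n_ge2 i) (ord0 : 'I_1) ord0.
  pose Y i := unit_mx (leavitt_y K n_ge2 i) (ord0 : 'I_1) ord0.
  have one1 : unit_mx 1 ord0 ord0 = 1 :> 'M[leavitt K n_ge2]_1.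
    by rewrite -sum_unit_mx big_ord1.
  apply: (@leavitt_iso_mx K n n_ge2 0 X Y) => [i j||A sA AX AY].
  - rewrite unit_mxM eqxx xy -one1; case: (i == j) => //; exact: unit_mx0.
  - under eq_bigr => j _ do rewrite unit_mxM eqxx.
    by rewrite -unit_mx_sum yx one1.
  have A1 : A (unit_mx 1 ord0 ord0) by rewrite one1; case: sA.
  apply: (subalgebra_full gen sA) => [i|i|r|r]; first exact: AX.
  - exact: AY.
  - by rewrite (ord1 r).
  by rewrite (ord1 r).
have n1 : (0 < n.-1)%N by rewrite -subn1 subn_gt0.
have [u v uv _] := egcdnP d.+2 n1.
rewrite gcdnC dn in uv.
(* The Bezout relation [uv] makes [u] an inverse of [n - 1] modulo [d.+2]; its residue [m] is the
   density parameter of the colouring. *)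
pose m := (u %% d.+2)%N; pose k := (n.-1 * m %/ d.+2)%N.
have m_inverse : (n.-1 * m = 1 + d.+2 * k)%N.
  rewrite /k {1}(divn_eq (n.-1 * m) d.+2) addnC [(d.+2 * _)%N]mulnC; congr (_ + _)%N.
  by rewrite modnMmr mulnC uv modnMDl modn_small.
have m_bounds : (0 < m < d.+2)%N.
  rewrite ltn_pmod // andbT; have [m0|//] := posnP m.
  by move: m_inverse; rewrite m0 muln0.
have [leaves lp lc] := coloured_caterpillar (erefl : Ordinal (ltnW n_ge2) = 0%N :> nat)
  m_bounds m_inverse.
apply: (leavitt_iso_mx (mx_xy xy lp) (mx_yx yx lp)) => A sA AX AY.
exact: (mx_generated yx gen lp m_bounds m_inverse lc sA AX AY).
Qed.
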